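(* Let $q\equiv 2\pmod 3$ be a prime power, $m=(q+1)/3$, and let $P=P_{(a,b)}\in\mathcal X_3(\overline{\mathbb F}_{q^2})\setminus\mathcal X_3(\mathbb F_{q^2})$ be such that $\mathcal P_j(\alpha(P))\neq0$ for all $j=2,\dots,m-1$. Then the set of gaps at $P$ is $$G(P)=\{jq+k\mid j=0,\dots,m-2,\ k=1,\dots,q-3j-2\}\cup\{(m-1)q+1\},$$ equivalently $$H(P)=\{0\}\cup\{(j+1)(q-3)+2+k\mid j=0,\dots,m-2,\ k=0,\dots,3j+1\}\cup\{n\in\mathbb Z: n\ge (m-1)q+2\}.$$
   Context: Let $\mathcal X_3$ be the nonsingular projective model (defined over $\mathbb F_{q^2}$) of the plane curve $y^{q+1}+x^{2m}+x^m=0$. The points of $\mathcal X_3$ not centered at $(0,0)$ and not over the point at infinity have affine coordinates $(a,b)$ with $a\ne 0$ and are denoted $P_{(a,b)}$; for such a point with $a^m\neq-1$ put $\alpha(P_{(a,b)})=a^m/(1+a^m)$. Fix a primitive cube root of unity $\zeta_3\in\mathbb F_{q^2}$ and let $\mathcal P_i(s)=\frac{(s+\zeta_3)^{3i}-(s+\zeta_3^2)^{3i}}{3(\zeta_3-\zeta_3^2)s(s-1)}$ for $i\in\mathbb Z$ (a polynomial for $i\geq1$). $H(P)$ is the Weierstrass semigroup at $P$: integers $n\ge0$ such that some function on $\mathcal X_3$ has pole divisor exactly $nP$; $G(P)$ is the set of positive integers not in $H(P)$ (gaps). *)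

(* Defs.v *)
From HB Require Import structures.
From mathcomp Require Import all_boot all_order all_algebra.
Set Implicit Arguments. Unset Strict Implicit. Unset Printing Implicit Defensive.
Import Order.TTheory GRing.Theory Num.Theory.
Local Open Scope ring_scope.

(* A normalized discrete valuation of F trivial on (the image of) K.
   For an algebraic function field F/K these are exactly the places of F/K
   (v is only meaningful on nonzero elements). *)
Definition is_place_valuation (K F : fieldType) (iota : {rmorphism K -> F})
    (v : F -> int) : Prop :=
  [/\ forall f g : F, f != 0 -> g != 0 -> v (f * g) = v f + v g,
      forall f g : F, f != 0 -> g != 0 -> f + g != 0 ->
        Num.min (v f) (v g) <= v (f + g),
      forall c : K, c != 0 -> v (iota c) = 0
    & exists t : F, t != 0 /\ v t = 1].

Definition same_place (F : fieldType) (v w : F -> int) : Prop :=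
  forall f : F, f != 0 -> v f = w f.

Definition in_weierstrass (K F : fieldType) (iota : {rmorphism K -> F})
    (v : F -> int) (n : nat) : Prop :=
  exists f : F, [/\ f != 0, v f = - (n%:Z) &
    forall w : F -> int, is_place_valuation iota w -> ~ same_place w v ->
      0 <= w f].

Definition ev2 (K F : fieldType) (iota : {rmorphism K -> F}) (x y : F)
    (P : {poly {poly K}}) : F :=
  (map_poly (fun c : {poly K} => (map_poly iota c).[x]) P).[y].

Definition is_function_field_X3 (K F : fieldType) (iota : {rmorphism K -> F})
    (q m : nat) (x y : F) : Prop :=
  [/\ forall p : {poly K}, p != 0 -> (map_poly iota p).[x] != 0,
      y ^+ q.+1 + x ^+ (2 * m) + x ^+ m = 0
    & forall f : F, exists P Q : {poly {poly K}},
        ev2 iota x y Q != 0 /\ f = ev2 iota x y P / ev2 iota x y Q].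

Definition alpha (K : fieldType) (m : nat) (a : K) : K := a ^+ m / (1 + a ^+ m).

(* value of the polynomial P_i at s (valid for s <> 0,1, where the
   defining quotient is exact) *)
Definition Pval (K : fieldType) (zeta : K) (i : nat) (s : K) : K :=
  ((s + zeta) ^+ (3 * i) - (s + zeta ^+ 2) ^+ (3 * i)) /
  (3%:R * (zeta - zeta ^+ 2) * s * (s - 1)).

(* Main.v *)
Require Import Defs.
From Stdlib Require Import ClassicalEpsilon.
From HB Require Import structures.
From mathcomp Require Import all_boot all_order all_algebra all_field.
From mathcomp Require Import ring zify.
Import Order.TTheory GRing.Theory Num.Theory.
Local Open Scope ring_scope.
Set Implicit Arguments. Unset Strict Implicit. Unset Printing Implicit Defensive.

(* With [x = u^3] and [y = u w] the curve is the quotient of the Hermitian curve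
   [u^(q+1) + w^(q+1) + 1 = 0] by [(u, w) -> (zeta u, zeta^-1 w)], whose invariants are
   [x], [y] and [z = w^3 = y^3 / x].  The tangent line at a point above [P = (a, b)] has
   contact of order [q] there and meets the Hermitian curve once more, above the
   conjugate [P'] of [P] under the [q^2]-Frobenius map.  The product of its three
   conjugates is, in the coordinates [X = a^q x], [Y = b^q y], [Z = Y^3 / X], the function
   [lam = X + Z + 1 - 3 Y], whose zero divisor is [q P + P'].

   Hence the functions with poles only at [P], of order at most [k q], are the quotients
   [N / lam^k] with [N] a polynomial of degree at most [k] in [x, y, z] vanishing to
   order [k] at [P'].  That [N] is such a polynomial is seen on the Kummer basis
   [z^l y^j] ([l < m], [j < 3]) of the function field over [K(x)]; this needs a place at
   every point of the curve, which is built from its local ring.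

   On the tangent line, with parameter [t], the invariants become [t^3], [-t - t^2],
   [-(1 + t)^3]; so [N] restricts to a polynomial [g(t)] of degree at most [3 k] with
   [g(zeta) = g(zeta^2)], every such [g] occurs, and orders below [q] at [P] are
   multiplicities of [g] at [s = a^m].  Vanishing at [P'] is [g(s^q) = 0], and the higher
   order conditions at [P'] are met by subtracting a polynomial in [1 / lam].  The order
   [3 k - 1] occurs only if [(t - s)^(3 k - 1) (t - s^q)] takes equal values at [zeta] and
   [zeta^2].  Since [(t - s)^q (t - s^q)], which is the equation of the curve, does so,
   this means that [P_(m - k)] vanishes at [alpha P]. *)

(** * Valuations and residues *)

Section Valuation.
Context {K F : fieldType} {iota : {rmorphism K -> F}}.
Implicit Types (v w : F -> int) (f g : F) (n : int).

(* Valuations are unspecified at [0]; [vge v n f] treats [0] as having infinite order. *)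
Definition vge v n f : bool := (f == 0) || (n <= v f).

Lemma vge0 v n : vge v n 0.
Proof. by rewrite /vge eqxx. Qed.

Lemma vgeE v n f : f != 0 -> vge v n f = (n <= v f).
Proof. by rewrite /vge => /negbTE ->. Qed.

Lemma vgeW v n n' f : n' <= n -> vge v n f -> vge v n' f.
Proof.
rewrite /vge => le_n /orP [-> //|le_v]; apply/orP; right; exact: le_trans le_v.
Qed.

Context {v : F -> int} (hv : is_place_valuation iota v).

Lemma vM f g : f != 0 -> g != 0 -> v (f * g) = v f + v g.
Proof. by case: hv => h _ _ _; apply: h. Qed.

Lemma v_iota c : c != 0 -> v (iota c) = 0.
Proof. by case: hv => _ _ h _; apply: h. Qed.

Lemma v1 : v 1 = 0.
Proof. by rewrite -(rmorph1 iota) v_iota ?oner_neq0. Qed.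

Lemma vN f : f != 0 -> v (- f) = v f.
Proof.
move=> f0; rewrite -mulN1r vM ?oppr_eq0 ?oner_neq0 //.
by rewrite -(rmorph1 iota) -rmorphN v_iota ?add0r // oppr_eq0 oner_neq0.
Qed.

Lemma vV f : f != 0 -> v f^-1 = - v f.
Proof.
move=> f0; apply/eqP; rewrite -subr_eq0 opprK addrC -vM ?invr_eq0 //.
by rewrite divff // v1.
Qed.

Lemma vX f k : f != 0 -> v (f ^+ k) = v f *+ k.
Proof.
move=> f0; elim: k => [|k IH]; first by rewrite expr0 v1.
by rewrite exprS vM ?expf_neq0 // IH mulrS.
Qed.

Lemma vgeD n f g : vge v n f -> vge v n g -> vge v n (f + g).
Proof.
rewrite /vge; have [->|f0] := eqVneq f 0; first by rewrite add0r.
have [->|g0] := eqVneq g 0; first by rewrite addr0 (negbTE f0) => ->.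
have [//|fg0] := eqVneq (f + g) 0 => /= hf hg.
case: hv => _ h _ _; apply: le_trans (h _ _ f0 g0 fg0).
by rewrite le_min hf hg.
Qed.

Lemma vgeM n n' f g : vge v n f -> vge v n' g -> vge v (n + n') (f * g).
Proof.
rewrite /vge; have [->|f0] := eqVneq f 0; first by rewrite mul0r eqxx.
have [->|g0] := eqVneq g 0; first by rewrite mulr0 eqxx.
by rewrite mulf_eq0 (negbTE f0) (negbTE g0) /= vM //; apply: lerD.
Qed.

Lemma vge0M n f g : vge v 0 f -> vge v n g -> vge v n (f * g).
Proof. by move=> /vgeM h /h; rewrite add0r. Qed.

Lemma vgeM0 n f g : vge v n f -> vge v 0 g -> vge v n (f * g).
Proof. by rewrite mulrC => hf hg; apply: vge0M. Qed.

Lemma vgeN n f : vge v n (- f) = vge v n f.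
Proof.
rewrite /vge oppr_eq0; have [//|f0] := eqVneq f 0; by rewrite vN.
Qed.

Lemma vgeB n f g : vge v n f -> vge v n g -> vge v n (f - g).
Proof. by move=> hf hg; apply: vgeD; rewrite ?vgeN. Qed.

Lemma vge_iota c : vge v 0 (iota c).
Proof.
have [->|c0] := eqVneq c 0; first by rewrite rmorph0 vge0.
by rewrite vgeE ?fmorph_eq0 // v_iota.
Qed.

Lemma vge_nat k : vge v 0 k%:R.
Proof. by rewrite -(rmorph_nat iota) vge_iota. Qed.

Lemma vge1 : vge v 0 1.
Proof. exact: (vge_nat 1). Qed.

Lemma vgeX n f k : vge v n f -> vge v (n *+ k) (f ^+ k).
Proof.
move=> hf; elim: k => [|k IH]; first by rewrite mulr0n expr0 vge1.
by rewrite mulrS exprS vgeM.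
Qed.

Lemma vge0X f k : vge v 0 f -> vge v 0 (f ^+ k).
Proof. by move=> /(vgeX k); rewrite mul0rn. Qed.

Lemma vge_sum n (I : Type) (r : seq I) (P : pred I) (E : I -> F) :
  (forall i, P i -> vge v n (E i)) -> vge v n (\sum_(i <- r | P i) E i).
Proof.
move=> hE; elim/big_rec: _ => [|i f Pi hf]; first exact: vge0.
by apply: vgeD => //; apply: hE.
Qed.

Lemma vge_horner n (p : {poly F}) f :
  (forall i, vge v n p`_i) -> vge v 0 f -> vge v n p.[f].
Proof.
move=> hp hf; rewrite horner_coef; apply: vge_sum => i _.
by apply: vgeM0 => //; apply: vge0X.
Qed.

Lemma vge_poly (p : {poly K}) f : vge v 0 f -> vge v 0 (map_poly iota p).[f].
Proof. by apply: vge_horner => i; rewrite coef_map; apply: vge_iota. Qed.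

Lemma vgeX_inv f k : (0 < k)%N -> vge v 0 (f ^+ k) -> vge v 0 f.
Proof.
move=> k0; have [->|f0] := eqVneq f 0; first by rewrite vge0.
by rewrite !vgeE ?expf_neq0 // vX // pmulrn_lge0.
Qed.

Lemma vgeMr n f g : f != 0 -> vge v n (f * g) = vge v (n - v f) g.
Proof.
move=> f0; have [->|g0] := eqVneq g 0; first by rewrite mulr0 !vge0.
by rewrite !vgeE ?mulf_neq0 // vM // lerBlDl.
Qed.

Lemma vD_eq n f g : f != 0 -> v f = n -> vge v (n + 1) g ->
  f + g != 0 /\ v (f + g) = n.
Proof.
move=> f0 vf hg.
have fg0 : f + g != 0.
  apply/negP; rewrite addr_eq0 => /eqP def_f.
  by move: hg; rewrite -vgeN -def_f vgeE // vf; lia.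
split=> //; have le1 : vge v n (f + g).
  by apply: vgeD; [rewrite vgeE // vf | apply: vgeW hg; lia].
rewrite vgeE // in le1; apply/eqP; rewrite eq_le le1 andbT leNgt.
apply/negP => lt_n.
have: vge v (n + 1) (f + g - g) by apply: vgeB => //; rewrite vgeE //; lia.
by rewrite addrK vgeE // vf; lia.
Qed.

(** Residues form a relation: that a function of nonnegative order has a residue in [K] is a theorem
    about places of the curve, proved only later. *)
Definition res f c := vge v 1 (f - iota c).

Lemma res_vge0 f c : res f c -> vge v 0 f.
Proof.
move=> /(@vgeW _ _ 0) h; rewrite -[f](subrK (iota c)).
by apply: vgeD; [apply: h | apply: vge_iota].
Qed.

Lemma res_iota c : res (iota c) c.
Proof. by rewrite /res subrr vge0. Qed.

Lemma res0 f : res f 0 = vge v 1 f.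
Proof. by rewrite /res rmorph0 subr0. Qed.

Lemma res_nat k : res k%:R k%:R.
Proof. by rewrite -(rmorph_nat iota); apply: res_iota. Qed.

Lemma res1 : res 1 1.
Proof. exact: (res_nat 1). Qed.

Lemma resD f g c d : res f c -> res g d -> res (f + g) (c + d).
Proof. by rewrite /res rmorphD opprD addrACA; apply: vgeD. Qed.

Lemma resN f c : res f c -> res (- f) (- c).
Proof. by rewrite /res rmorphN -opprD vgeN. Qed.

Lemma resB f g c d : res f c -> res g d -> res (f - g) (c - d).
Proof. by move=> hf hg; apply/resD/resN. Qed.

Lemma resM f g c d : res f c -> res g d -> res (f * g) (c * d).
Proof.
move=> hf hg; rewrite /res rmorphM.
have ->: f * g - iota c * iota d = (f - iota c) * g + iota c * (g - iota d).
  by ring.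
apply: vgeD; first by apply: vgeM0 => //; apply: res_vge0 hg.
by apply: vge0M => //; apply: vge_iota.
Qed.

Lemma resX f c k : res f c -> res (f ^+ k) (c ^+ k).
Proof.
move=> hf; elim: k => [|k IH]; first by rewrite !expr0 res1.
by rewrite !exprS resM.
Qed.

Lemma res_sum (I : Type) (r : seq I) (P : pred I) (E : I -> F) (e : I -> K) :
  (forall i, P i -> res (E i) (e i)) ->
  res (\sum_(i <- r | P i) E i) (\sum_(i <- r | P i) e i).
Proof.
move=> hE; elim/big_rec2: _ => [|i f c Pi hf]; first by rewrite res0 vge0.
by apply: resD => //; apply: hE.
Qed.

Lemma res_poly (p : {poly K}) f c : res f c -> res (map_poly iota p).[f] p.[c].
Proof.
move=> hf; rewrite !horner_coef size_map_poly; apply: res_sum => i _.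
by apply: resM; [rewrite coef_map; apply: res_iota | apply: resX].
Qed.

Lemma res_unit f c : res f c -> c != 0 -> f != 0 /\ v f = 0.
Proof.
move=> hf c0; rewrite -[f](subrK (iota c)) addrC.
by apply: (@vD_eq 0); rewrite ?fmorph_eq0 ?v_iota.
Qed.

Lemma res_uniq f c d : res f c -> res f d -> c = d.
Proof.
move=> hc hd; apply/eqP; apply/negPn/negP; rewrite -subr_eq0 => cd0.
have /res_unit /(_ cd0) [] := resB hc hd; by rewrite subrr eqxx.
Qed.

Lemma resV f c : res f c -> c != 0 -> res f^-1 c^-1.
Proof.
move=> hf c0; have [f0 vf] := res_unit hf c0.
rewrite /res fmorphV; have ic0 : iota c != 0 by rewrite fmorph_eq0.
have ->: f^-1 - (iota c)^-1 = (f * iota c)^-1 * - (f - iota c).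
  by field; rewrite f0 ic0.
rewrite vgeMr ?invr_eq0 ?mulf_neq0 // vgeN vV ?mulf_neq0 // vM // vf v_iota //.
Qed.

Lemma res_div f g c d : res f c -> res g d -> d != 0 -> res (f / g) (c / d).
Proof. by move=> hf hg d0; apply: resM => //; apply: resV. Qed.

End Valuation.
Arguments res {K F} iota v f c.

Section ClosedResidue.
Context {K : closedFieldType} {F : fieldType} {iota : {rmorphism K -> F}}.
Context {v : F -> int} (hv : is_place_valuation iota v).

Lemma map_poly_horner_prod (p : {poly K}) f :
  exists r : seq K, p = lead_coef p *: \prod_(z <- r) ('X - z%:P) /\
  (map_poly iota p).[f] = iota (lead_coef p) * \prod_(z <- r) (f - iota z).
Proof.
have [r def_p] := closed_field_poly_normal p; exists r; split=> //.
rewrite {1}def_p linearZ /= hornerZ rmorph_prod horner_prod; congr (_ * _).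
by apply: eq_bigr => z _; rewrite rmorphB /= map_polyX map_polyC hornerXsubC.
Qed.

(** [p] splits over [K], so [p(f)] is, up to a constant, a product of factors [f - iota z]. If no
    [z] is a residue of [f], each factor has order exactly zero. *)
Lemma residue_root (p : {poly K}) f : p != 0 -> vge v 0 f ->
  vge v 1 (map_poly iota p).[f] -> exists2 c, root p c & res iota v f c.
Proof.
move=> p0 hf; have [r [def_p ->]] := map_poly_horner_prod p f.
have lp0 : lead_coef p != 0 by rewrite lead_coef_eq0.
rewrite (vgeMr hv) ?fmorph_eq0 // (v_iota hv) // subr0 => hr.
have {hr} [c cr fc] : exists2 c, c \in r & res iota v f c.
  elim: r {def_p} hr => [|c r IH].
    by rewrite big_nil vgeE ?oner_neq0 // (v1 hv).
  rewrite big_cons; case: (boolP (res iota v f c)) => [fc _|nfc hr].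
    by exists c; rewrite ?inE ?eqxx.
  have fc0 : f - iota c != 0 by apply: contraNneq nfc => h; rewrite /res h vge0.
  have vfc : v (f - iota c) = 0.
    have := vgeB hv hf (vge_iota hv c); rewrite vgeE //.
    by move: nfc; rewrite /res vgeE // -ltNge; move: (v _) => n; lia.
  move: hr; rewrite (vgeMr hv) // vfc subr0 => /IH [d dr fd].
  by exists d; rewrite // inE dr orbT.
by exists c => //; rewrite def_p rootZ // root_prod_XsubC.
Qed.

End ClosedResidue.

(** * Places from discrete valuation rings *)

Section DVR.
Context {K F : fieldType} {iota : {rmorphism K -> F}} (O : F -> Prop) (t : F).
Let U u := [/\ u != 0, O u & O u^-1].
Hypotheses (OD : forall f g, O f -> O g -> O (f + g))
  (OM : forall f g, O f -> O g -> O (f * g)) (OC : forall c, O (iota c))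
  (Ot : O t) (t0 : t != 0) (Ot' : ~ O t^-1)
  (dec : forall f, f != 0 -> exists n : int, exists2 u, U u & f = t ^ n * u).

Let OtX (n : nat) : O (t ^+ n).
Proof.
elim: n => [|n IH]; first by rewrite expr0 -(rmorph1 iota).
by rewrite exprS; apply: OM.
Qed.

Let Otz (n : int) u : U u -> O (t ^ n * u) -> 0 <= n.
Proof.
case: n => [//|n] [u0 Ou Ou'] /OM /(_ Ou'); rewrite mulfK // NegzE => On.
case: Ot'; suff ->: t^-1 = t ^ (- (n.+1)%:Z) * t ^+ n by apply: OM.
by rewrite -exprnN exprS invfM mulfVK ?expf_neq0.
Qed.

Let UM u w : U u -> U w -> U (u * w).
Proof.
move=> [u0 h1 h2] [w0 h3 h4]; split; [exact: mulf_neq0|exact: OM|].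
by rewrite invfM; apply: OM.
Qed.

Let UV u : U u -> U u^-1.
Proof. by move=> [u0 h1 h2]; split; rewrite ?invr_eq0 ?invrK. Qed.

Let uniq_n (n n' : int) u u' : U u -> U u' -> t ^ n * u = t ^ n' * u' -> n = n'.
Proof.
suff le m m' w w' : U w -> U w' -> t ^ m * w = t ^ m' * w' -> m' <= m.
  by move=> hu hu' e; apply/eqP; rewrite eq_le; apply/andP; split;
     [apply: le (esym e) | apply: le e].
move=> hw hw' e; have [w0 Ow _] := hw; have [w'0 Ow' _] := hw'.
have e2 : t ^ (m - m') * (w / w') = 1.
  by rewrite expfzDr // -invr_expz mulrACA e mulrACA divff ?expfz_neq0 // mul1r divff.
have: 0 <= m - m'; last by rewrite subr_ge0.
apply: Otz (UM hw (UV hw')) _; rewrite e2 -(rmorph1 iota); exact: OC.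
Qed.

(** The order of [f] is the exponent in [f = t ^ n * u]. It is unique because a negative power of
    [t] times a unit, if it lay in [O], would put [t^-1] in [O]. The same fact and the closure of
    [O] under addition give the triangle inequality. *)
Lemma dvr_place : exists2 w, is_place_valuation iota w &
  forall n u, U u -> w (t ^ n * u) = n.
Proof.
pose R f n := f != 0 -> exists2 u, U u & f = t ^ n * u.
have exR f : exists n, R f n.
  have [->|f0] := eqVneq f 0; first by exists 0; rewrite /R eqxx.
  by have [n hn] := dec f0; exists n.
(* Choice turns the existence of an exponent into a function; its value at [0] is arbitrary. *)
pose w f := proj1_sig (constructive_indefinite_description _ (exR f)).
have wP f : R f (w f) by rewrite /w; case: constructive_indefinite_description.
have w_eq n u : U u -> w (t ^ n * u) = n.
  move=> hu; have [u0 _ _] := hu.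
  have [|u' hu' e] := wP (t ^ n * u); first by rewrite mulf_neq0 ?expfz_neq0.
  exact: uniq_n hu' hu (esym e).
have wM f g : f != 0 -> g != 0 -> w (f * g) = w f + w g.
  move=> f0 g0; have [u hu e] := wP f f0; have [u' hu' e'] := wP g g0.
  by rewrite {1}e {1}e' mulrACA -expfzDr // w_eq //; apply: UM.
have U1 : U 1 by rewrite /U invr1 oner_neq0 -(rmorph1 iota).
have UC c : c != 0 -> U (iota c).
  by move=> c0; rewrite /U fmorph_eq0 c0 -fmorphV; split.
exists w => //; split=> //.
- suff main f g : f != 0 -> g != 0 -> f + g != 0 -> w f <= w g -> w f <= w (f + g).
    move=> f g f0 g0 fg0; case: (leP (w f) (w g)) => [|/ltW] h; first exact: main.
    by rewrite addrC; apply: main => //; rewrite addrC.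
  move=> f0 g0 fg0 le_fg.
  have [u hu e] := wP f f0; have [u' hu' e'] := wP g g0.
  have [x hx ex] := wP _ fg0.
  have [k def_k] : exists k : nat, w g - w f = k by exists `|w g - w f|%N; lia.
  have e2 : t ^ (w (f + g) - w f) * x = u + t ^+ k * u'.
    apply: (mulfI (expfz_neq0 (w f) t0)).
    by rewrite mulrA -expfzDr // [w f + _]addrC subrK -ex mulrDr mulrA -e
      exprnP -expfzDr // -def_k [w f + _]addrC subrK -e'.
  rewrite -subr_ge0; apply: Otz hx _; rewrite e2.
  have [[_ Ou _] [_ Ou' _]] := (hu, hu').
  by apply: OD => //; apply: OM.
- move=> c c0; have := w_eq 0 _ (UC c c0); by rewrite expr0z mul1r.
- by exists t; split=> //; have := w_eq 1 1 U1; rewrite expr1z mulr1.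
Qed.

End DVR.

(** * Functions on the curve *)

Section Evaluation.
Context {K F : fieldType} (iota : {rmorphism K -> F}) (x y : F).

Definition phi : {poly K} -> F := horner_eval x \o map_poly iota.
HB.instance Definition _ := GRing.RMorphism.copy phi (horner_eval x \o map_poly iota).

Definition ev : {poly {poly K}} -> F := horner_eval y \o map_poly phi.
HB.instance Definition _ := GRing.RMorphism.copy ev (horner_eval y \o map_poly phi).

Lemma ev2E P : ev2 iota x y P = ev P. Proof. by []. Qed.

Lemma phiE p : phi p = (map_poly iota p).[x]. Proof. by []. Qed.

Lemma phiX : phi 'X = x.
Proof. by rewrite phiE map_polyX hornerX. Qed.

Lemma phiC c : phi c%:P = iota c.
Proof. by rewrite phiE map_polyC hornerC. Qed.

Lemma phiXC c : phi ('X - c%:P) = x - iota c.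
Proof. by rewrite rmorphB /= phiX phiC. Qed.

Lemma phi0 : phi 0 = 0. Proof. exact: rmorph0. Qed.
Lemma phi1 : phi 1 = 1. Proof. exact: rmorph1. Qed.
Lemma phiD p r : phi (p + r) = phi p + phi r. Proof. exact: rmorphD. Qed.
Lemma phiN p : phi (- p) = - phi p. Proof. exact: rmorphN. Qed.
Lemma phiM p r : phi (p * r) = phi p * phi r. Proof. exact: rmorphM. Qed.
Lemma phiXn p n : phi (p ^+ n) = phi p ^+ n. Proof. exact: rmorphXn. Qed.

Lemma ev0 : ev 0 = 0. Proof. exact: rmorph0. Qed.
Lemma ev1 : ev 1 = 1. Proof. exact: rmorph1. Qed.
Lemma evD P Q : ev (P + Q) = ev P + ev Q. Proof. exact: rmorphD. Qed.
Lemma evN P : ev (- P) = - ev P. Proof. exact: rmorphN. Qed.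
Lemma evM P Q : ev (P * Q) = ev P * ev Q. Proof. exact: rmorphM. Qed.
Lemma evXn P n : ev (P ^+ n) = ev P ^+ n. Proof. exact: rmorphXn. Qed.

Lemma ev_big (I : Type) (r : seq I) (P : pred I) (E : I -> {poly {poly K}}) :
  ev (\sum_(i <- r | P i) E i) = \sum_(i <- r | P i) ev (E i).
Proof. exact: raddf_sum. Qed.

Lemma evX : ev 'X = y.
Proof. by rewrite /ev /= /horner_eval map_polyX hornerX. Qed.

Lemma evC p : ev p%:P = phi p.
Proof. by rewrite /ev /= /horner_eval map_polyC hornerC. Qed.

Lemma ev_sum (P : {poly {poly K}}) n : (size P <= n)%N ->
  ev P = \sum_(i < n) phi P`_i * y ^+ i.
Proof.
move=> sP; rewrite /ev /= /horner_eval (@horner_coef_wide _ n).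
  by apply: eq_bigr => i _; rewrite coef_map.
exact: leq_trans (size_poly _ _) sP.
Qed.

Lemma ev_horner (p : {poly {poly K}}) P : ev (map_poly polyC p).[P] = (map_poly phi p).[ev P].
Proof.
rewrite -horner_map -map_poly_comp; congr (_.[_]).
by apply: eq_map_poly => c /=; rewrite evC.
Qed.

End Evaluation.

Definition pt {K : fieldType} (c b : K) : {poly {poly K}} -> K :=
  horner_eval c \o horner_eval b%:P.
HB.instance Definition _ (K : fieldType) (c b : K) :=
  GRing.RMorphism.copy (pt c b) (horner_eval c \o horner_eval b%:P).

Lemma ptE (K : fieldType) (c b : K) P : pt c b P = P.[b%:P].[c]. Proof. by []. Qed.

Section PointEvaluation.
Context {K : fieldType} (c b : K).
Local Notation pt := (pt c b).

Lemma ptX : pt 'X = b.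
Proof. by rewrite ptE hornerX hornerC. Qed.

Lemma ptC p : pt p%:P = p.[c].
Proof. by rewrite ptE hornerC. Qed.

Lemma pt1 : pt 1 = 1. Proof. exact: rmorph1. Qed.
Lemma ptD P Q : pt (P + Q) = pt P + pt Q. Proof. by rewrite !ptE !hornerD. Qed.
Lemma ptN P : pt (- P) = - pt P. Proof. by rewrite !ptE !hornerN. Qed.
Lemma ptM P Q : pt (P * Q) = pt P * pt Q. Proof. by rewrite !ptE !hornerM. Qed.
Lemma ptXn P n : pt (P ^+ n) = pt P ^+ n. Proof. by rewrite !ptE !horner_exp. Qed.

Lemma pt_sum (P : {poly {poly K}}) n : (size P <= n)%N ->
  pt P = \sum_(i < n) (P`_i).[c] * b ^+ i.
Proof.
move=> sP; rewrite ptE (horner_coef_wide _ sP) horner_sum.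
by apply: eq_bigr => i _; rewrite hornerM -polyC_exp hornerC.
Qed.

End PointEvaluation.

(** * The function field as an extension of [K(x)] *)

Section FunctionField.
Context {K : closedFieldType} {F : fieldType} {iota : {rmorphism K -> F}}.
Context {q m : nat} (hq : q.+1 = (3 * m)%N) (m_gt0 : (0 < m)%N) (qK : q%:R = 0 :> K).
Context {x y : F} (hF : is_function_field_X3 iota q m x y).

Local Notation phi := (phi iota x).
Local Notation ev := (ev iota x y).

Lemma phi_neq0 p : p != 0 -> phi p != 0.
Proof. by case: hF => h _ _; apply: h. Qed.

Lemma phi_inj p r : phi p = phi r -> p = r.
Proof.
move=> e; apply/eqP; rewrite -subr_eq0; apply: contraTT isT => /phi_neq0.
by rewrite phiD phiN e subrr eqxx.
Qed.

Lemma x_neq c : x - iota c != 0.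
Proof. by rewrite -(phiXC iota x) phi_neq0 ?polyXsubC_eq0. Qed.

Lemma x_neq0 : x != 0.
Proof. by have := x_neq 0; rewrite rmorph0 subr0. Qed.

Lemma curve_eq : y ^+ q.+1 = - (x ^+ (2 * m) + x ^+ m).
Proof. by case: hF => _ h _; apply/eqP; rewrite -addr_eq0 addrA h. Qed.

Lemma curve_eq_phi : y ^+ q.+1 = phi (- ('X^m * ('X^m + 1))).
Proof.
rewrite curve_eq phiN phiM phiD !phiXn phiX phi1.
by rewrite mulrDr mulr1 -exprD addnn -mul2n.
Qed.

Lemma mK : m%:R != 0 :> K.
Proof.
apply/negP => /eqP m0; have := congr1 (fun n : nat => n%:R : K) hq.
by rewrite -natr1 qK add0r natrM m0 mulr0 => /eqP; rewrite oner_eq0.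
Qed.

Lemma y_neq0 : y != 0.
Proof.
apply/negP => /eqP y0; have := curve_eq_phi; rewrite y0 expr0n /= => /esym/eqP.
apply/negP; apply: phi_neq0.
rewrite oppr_eq0 mulf_neq0 ?expf_neq0 ?polyX_eq0 //.
by rewrite -size_poly_eq0 size_XnaddC.
Qed.

Lemma integral_ev P : integralOver phi (ev P).
Proof.
apply: integral_horner => [|] /=.
  move=> r /(nthP 0) [i _ <-]; rewrite coef_map; exact: integral_id.
exists ('X^(q.+1) - (- ('X^m * ('X^m + 1)))%:P); first by rewrite monicXnsubC.
rewrite rmorphB /= map_polyXn map_polyC /root hornerD hornerN hornerXn hornerC.
by rewrite curve_eq_phi subrr.
Qed.

Definition curve_poly : {poly {poly K}} := 'X^(q.+1) - (- ('X^m * ('X^m + 1)))%:P.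

Lemma ev_curve : ev curve_poly = 0.
Proof. by rewrite evD evN evXn evX evC curve_eq_phi subrr. Qed.

Lemma reduce_curve P : exists Q R, P = Q * curve_poly + R /\ (size R <= q.+1)%N.
Proof.
have monC : curve_poly \is monic by rewrite monicXnsubC.
exists (Pdiv.CommonRing.rdivp P curve_poly), (Pdiv.CommonRing.rmodp P curve_poly).
split; first exact: Pdiv.RingMonic.rdivp_eq.
by have := Pdiv.Ring.ltn_rmodpN0 P (monic_neq0 monC); rewrite size_XnsubC.
Qed.

(** [ev B] is integral over [K[x]]. Clearing denominators in its equation, written for
    [W / (x - c)], leaves a power of [W] plus multiples of [X - c]; evaluate at [c]. *)
Lemma phi_dvd_ev c W B : phi W = (x - iota c) * ev B -> root W c.
Proof.
move=> eW; have [p mon_p rp] := integral_ev B.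
pose n := (size p).-1; have sp : size p = n.+1.
  by rewrite prednK // size_poly_gt0 monic_neq0.
have e0 : \sum_(i < n.+1) p`_i * W ^+ i * ('X - c%:P) ^+ (n - i) = 0.
  apply: phi_inj; rewrite rmorph0 rmorph_sum /=.
  move/rootP: rp; rewrite (@horner_coef_wide _ n.+1); last by rewrite -sp size_poly.
  move/(congr1 ( *%R ((x - iota c) ^+ n))); rewrite mulr0 mulr_sumr => e.
  rewrite -[RHS]e; apply: eq_bigr => i _; rewrite coef_map !rmorphM !rmorphXn /=.
  have -> : (x - iota c) ^+ n = (x - iota c) ^+ (n - i) * (x - iota c) ^+ i.
    by rewrite -exprD subnK // -ltnS.
  by rewrite phiXC eW exprMn; ring.
have := congr1 (fun r : {poly K} => r.[c]) e0; rewrite horner0 horner_sum big_ord_recr /=.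
rewrite big1 => [|i _]; last first.
  by rewrite !(hornerM, horner_exp) hornerXsubC subrr expr0n subn_eq0 leqNgt ltn_ord mulr0.
rewrite subnn expr0 mulr1 add0r hornerM horner_exp.
have -> : p`_n = 1 by have /monicP := mon_p; rewrite lead_coefE -/n.
by rewrite hornerC mul1r => /eqP; rewrite expf_eq0 => /andP [_ ?].
Qed.

(** The constant term of an integral equation of [ev P] is a multiple of [ev P]. Factors [X] are
    stripped from the equation until this term is nonzero. *)
Lemma norm_ev P : ev P != 0 -> exists P' D, D != 0 /\ ev P * ev P' = phi D.
Proof.
move=> g0; have [p mon_p rp] := integral_ev P.
have := monic_neq0 mon_p; move: rp; rewrite /root.
elim/poly_ind: p {mon_p} => [|p c IH]; first by rewrite eqxx.
have [->|c0] := eqVneq c 0.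
  rewrite addr0 rmorphM /= map_polyX hornerMX mulf_eq0 (negbTE g0) orbF mulf_eq0.
  by rewrite polyX_eq0 orbF.
rewrite rmorphD rmorphM /= map_polyX map_polyC hornerMXaddC => /eqP e _.
exists (map_poly polyC p).[P], (- c); split; first by rewrite oppr_eq0.
by rewrite ev_horner mulrC phiN; apply/eqP; rewrite -addr_eq0; apply/eqP.
Qed.

(** The root is simple: the derivative [m X^(m-1)] does not vanish at [c], since [m] is invertible
    in [K]. *)
Lemma root_Xm c : c ^+ m = -1 -> exists2 k : {poly K},
  'X^m + 1 = ('X - c%:P) * k & k.[c] != 0.
Proof.
move=> cm; have : root ('X^m + 1) c.
  by rewrite /root !hornerE cm addNr.
move/factor_theorem => [k ek]; exists k; first by rewrite mulrC.
have := congr1 (fun r : {poly K} => r^`().[c]) ek.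
rewrite derivD derivXn derivC addr0 derivM derivXsubC mulr1.
rewrite hornerMn hornerXn hornerD hornerM hornerXsubC subrr mulr0 add0r => <-.
rewrite -mulr_natr mulf_neq0 ?mK // expf_neq0 //.
apply/negP => /eqP c0; move: cm; rewrite c0 expr0n eqn0Ngt m_gt0 /= => /eqP.
by rewrite eq_sym oppr_eq0 oner_eq0.
Qed.

Lemma exists_root_m : exists c : K, c ^+ m = -1.
Proof.
have /closed_rootP [c] : size ('X^m + 1 : {poly K}) != 1%N.
  by rewrite size_XnaddC // eqSS -lt0n.
by rewrite /root !hornerE addr_eq0 => /eqP; exists c.
Qed.

(* Eisenstein's criterion at a root [c] of [X^m + 1]. *)
Lemma ev_indep (R : {poly {poly K}}) : (size R <= q.+1)%N -> ev R = 0 -> R = 0.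
Proof.
have [c cm] := exists_root_m; have [k ek kc] := root_Xm cm.
have [n] := ubnP (size (lead_coef R)).
elim: n R => // n IH R sn sR eR; apply/eqP/negPn/negP => R0.
(* If [X - c] divides every coefficient, it can be cancelled, which lowers the degree of the leading
   coefficient. *)
have [rootR|] := boolP [forall i : 'I_(size R), root R`_i c].
  have rR i : root R`_i c.
    case: (ltnP i (size R)) => hi; first exact: (forallP rootR (Ordinal hi)).
    by rewrite nth_default // root0.
  pose R' : {poly {poly K}} := \poly_(i < size R) (R`_i %/ ('X - c%:P)).
  have defR : R = ('X - c%:P)%:P * R'.
    apply/polyP => i; rewrite coefCM coef_poly; case: ltnP => hi.
      by rewrite mulrC divpK // dvdp_XsubCl.
    by rewrite mulr0 nth_default.
  have R'0 : R' != 0 by apply: contraNneq R0 => h; rewrite defR h mulr0.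
  have Xc0 : 'X - c%:P != 0 :> {poly K} by rewrite polyXsubC_eq0.
  have lR : lead_coef R = ('X - c%:P) * lead_coef R'.
    by rewrite defR lead_coefM lead_coefC.
  case/eqP: (R'0); apply: IH; last first.
  - move/eqP: eR; rewrite defR evM evC phiXC mulf_eq0 (negbTE (x_neq c)).
    by move/eqP.
  - exact: leq_trans (size_poly _ _) sR.
  - by move: sn; rewrite lR size_mul ?lead_coef_eq0 // size_XsubC.
rewrite negb_forall => /existsP [i0 hi0].
have exj : exists j, ~~ root R`_j c by exists i0.
(* [j] is the least index whose coefficient does not vanish at [c]. After multiplication by
   [y^(q-j)] all other terms are divisible by [x - c]: those below [j] by minimality, those above
   because they contain [y^(q+1)]. *)
case: (ex_minnP exj) => j hj minj.
have jq : (j <= q)%N.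
  rewrite -ltnS leqNgt; apply: contra hj => lt_j.
  by rewrite nth_default ?root0 // (leq_trans sR).
pose D f := exists B, f = (x - iota c) * ev B.
have DM f B : D f -> D (f * ev B).
  by move=> [B' ->]; exists (B' * B); rewrite evM mulrA.
have DD f g : D f -> D g -> D (f + g).
  by move=> [B ->] [B' ->]; exists (B + B'); rewrite evD mulrDr.
have DN f : D f -> D (- f).
  by move=> [B ->]; exists (- B); rewrite evN mulrN.
have evXl l : ev 'X^l = y ^+ l by rewrite evXn evX.
have yq : y ^+ q.+1 = (x - iota c) * ev (- ('X^m * k))%:P.
  by rewrite curve_eq_phi ek evC -(phiXC iota) -phiM mulrN mulrCA.
have [B eB] : D (phi R`_j * y ^+ q).
  have hsum : \sum_(i < q.+1) phi R`_i * y ^+ i * y ^+ (q - j) = 0.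
    by rewrite -mulr_suml -ev_sum // eR mul0r.
  have jq1 : (j < q.+1)%N by [].
  rewrite (bigD1 (Ordinal jq1)) //= -mulrA -exprD subnKC // in hsum.
  move/eqP: hsum; rewrite addr_eq0 => /eqP ->.
  apply: DN; elim/big_rec: _ => [|i f ij Df].
    by exists 0; rewrite ev0 mulr0.
  apply: DD => //; have {}ij : (i : nat) != j by [].
  move: ij; rewrite neq_ltn => /orP [lt_ij|lt_ji].
    rewrite -!evXl; apply: (DM); apply: (DM).
    have /factor_theorem [r ->] : root R`_i c.
      by apply: contraTT lt_ij => /minj; rewrite -leqNgt.
    by exists r%:P; rewrite phiM phiXC evC mulrC.
  rewrite -mulrA -exprD; have -> : (i + (q - j) = q.+1 + (i - j.+1))%N by lia.
  rewrite exprD yq -evXl -(evC iota x y) -mulrA -evM mulrCA -evM.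
  by eexists; reflexivity.
(* As [y^(q+1)] contains [x - c] once, the power [q + 1] of this relation has [q] explicit factors
   [x - c] on the left and [q + 1] on the right. *)
have := congr1 (fun f => f ^+ q.+1) eB.
rewrite /= !exprMn -exprM mulnC exprM yq evC exprMn.
rewrite [(x - iota c) ^+ q.+1]exprSr mulrCA -[RHS]mulrA => e.
have Xc0 : (x - iota c) ^+ q != 0 by rewrite expf_neq0 // x_neq.
have {e} := mulfI Xc0 e; rewrite -evXn -!phiXn -phiM => /phi_dvd_ev.
rewrite /root hornerM !horner_exp mulf_eq0 !expf_eq0 => /orP [/andP [_ rj]|].
  by rewrite /root rj in hj.
have c0 : c != 0.
  apply/negP => /eqP c0; move: cm; rewrite c0 expr0n eqn0Ngt m_gt0 /= => /eqP.
  by rewrite eq_sym oppr_eq0 oner_eq0.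
move=> /andP [_]; rewrite hornerN hornerM hornerXn oppr_eq0 mulf_eq0 (negbTE kc) orbF.
by rewrite expf_eq0 (negbTE c0) andbF.
Qed.

End FunctionField.

(** * Local rings and places *)

Section Points.
Context {K : closedFieldType} {F : fieldType} {iota : {rmorphism K -> F}}.
Context {q m : nat} (hq : q.+1 = (3 * m)%N) (m_gt0 : (0 < m)%N) (qK : q%:R = 0 :> K).
Context {x y : F} (hF : is_function_field_X3 iota q m x y).
Context {c b : K} (hcb : b ^+ q.+1 + c ^+ (2 * m) + c ^+ m = 0).

Local Notation phi := (phi iota x).
Local Notation ev := (ev iota x y).
Local Notation pt := (pt c b).

(** Division by the monic curve polynomial and the independence of [1, ..., y^q] over [K[x]] show
    that this polynomial generates the kernel of [ev]. So the value at [(c, b)] depends on the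
    function only. *)
Lemma pt_ker P : ev P = 0 -> pt P = 0.
Proof.
have ptC0 : pt (@curve_poly K q m) = 0.
  rewrite ptD ptN ptXn ptX ptC hornerN hornerM hornerD hornerXn hornerC.
  by rewrite opprK mulrDr mulr1 -exprD addnn -mul2n addrA.
have [Q [R [-> sR]]] := @reduce_curve K q m P; rewrite evD evM (ev_curve hF) mulr0 add0r.
by move=> /(ev_indep hq m_gt0 qK hF sR) ->; rewrite addr0 ptM ptC0 mulr0.
Qed.

Definition regular f := exists P Q, pt Q != 0 /\ f = ev P / ev Q.

Definition runit u := [/\ u != 0, regular u & regular u^-1].

Lemma pt_ev_neq0 P : pt P != 0 -> ev P != 0.
Proof. by move=> h; apply/negP => /eqP /pt_ker e; rewrite e eqxx in h. Qed.

Lemma regular_ev P : regular (ev P).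
Proof. by exists P, 1; rewrite pt1 oner_neq0 ev1 divr1. Qed.

Lemma regular_phi p : regular (phi p).
Proof. by rewrite -(evC iota x y); apply: regular_ev. Qed.

Lemma regular_iota k : regular (iota k).
Proof. by rewrite -(phiC iota x); apply: regular_phi. Qed.

Lemma regularD f g : regular f -> regular g -> regular (f + g).
Proof.
move=> [P [Q [hQ ->]]] [P' [Q' [hQ' ->]]]; exists (P * Q' + P' * Q), (Q * Q').
by rewrite ptM mulf_neq0 // evD !evM addf_div ?pt_ev_neq0.
Qed.

Lemma regularM f g : regular f -> regular g -> regular (f * g).
Proof.
move=> [P [Q [hQ ->]]] [P' [Q' [hQ' ->]]]; exists (P * P'), (Q * Q').
by rewrite ptM mulf_neq0 // !evM mulf_div.
Qed.

Lemma runit_ev P : pt P != 0 -> runit (ev P).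
Proof.
move=> hP; split; [exact: pt_ev_neq0|exact: regular_ev|].
by exists 1, P; rewrite ev1 div1r.
Qed.

Lemma runitM u w : runit u -> runit w -> runit (u * w).
Proof.
move=> [u0 hu hu'] [w0 hw hw']; split; [exact: mulf_neq0|exact: regularM|].
by rewrite invfM; apply: regularM.
Qed.

Lemma runitV u : runit u -> runit u^-1.
Proof. by move=> [u0 hu hu']; split; rewrite ?invr_eq0 ?invrK. Qed.

Lemma runitX u n : runit u -> runit (u ^+ n).
Proof.
move=> hu; elim: n => [|n IH]; last by rewrite exprS; apply: runitM.
by rewrite expr0 -(ev1 iota x y); apply: runit_ev; rewrite pt1 oner_neq0.
Qed.

Section Uniformizer.
Context {T : {poly {poly K}}} {e : nat} (e_gt0 : (0 < e)%N) (T0 : pt T = 0)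
  (evT0 : ev T != 0).
Context (hx : exists2 u, runit u & x - iota c = ev T ^+ e * u)
  (hy : exists2 g, regular g & y - iota b = ev T * g).

Lemma uniformizer_nonunit : ~ regular (ev T)^-1.
Proof.
move=> [P [Q [hQ e1]]]; have Q0 := pt_ev_neq0 hQ.
have : ev (T * P - Q) = 0.
  by rewrite evD evN evM -[ev P](divfK Q0) -e1 mulrA divff // mul1r subrr.
move/pt_ker; rewrite ptD ptN ptM T0 mul0r add0r => /eqP.
by rewrite oppr_eq0 (negbTE hQ).
Qed.

(** By Taylor expansion, a polynomial vanishing at the point is a combination of [x - c] and
    [y - b], and both are multiples of [T]. *)
Lemma vanishing_dvd P : pt P = 0 -> exists2 g, regular g & ev P = ev T * g.
Proof.
have [u [_ hu _] ex] := hx; have [g hg ey] := hy.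
have [P' eP'] : exists P', P - P.[b%:P]%:P = P' * ('X - (b%:P)%:P).
  by apply/factor_theorem; rewrite /root hornerD hornerN hornerC subrr.
have {}eP' : P = P' * ('X - (b%:P)%:P) + P.[b%:P]%:P by rewrite -eP' subrK.
rewrite ptE => /rootP /factor_theorem [p ep].
have evT : regular (ev T) by apply: regular_ev.
have reT n : regular (ev T ^+ n) by rewrite -evXn; apply: regular_ev.
exists (ev P' * g + phi p * (ev T ^+ e.-1 * u)).
  by apply: regularD; do ?apply: regularM => //; [apply: regular_ev | apply: regular_phi].
rewrite {1}eP' evD evM evD evN evX !evC phiC ep phiM phiXC ex ey.
by rewrite -{1}(prednK e_gt0) exprS; ring.
Qed.

(** [T] is divided out as long as the function vanishes at the point. This stops: some multiple of
    [ev P] is a polynomial in [x], and [e] times its order at [c] bounds the number of divisions. *)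
Lemma regular_decomp P : ev P != 0 ->
  exists n : nat, exists2 u, runit u & ev P = ev T ^+ n * u.
Proof.
move=> P0; have [P' [D [D0 ePD]]] := norm_ev hF P0.
have [M [D1 [hD1 eD]]] : exists M D1, ~~ root D1 c /\ D = D1 * ('X - c%:P) ^+ M.
  by have [M [D1]] := multiplicity_XsubC D c; rewrite D0; exists M, D1.
have [u hu ex] := hx.
have : exists N g w, [/\ regular g, runit w & ev P * g = ev T ^+ N * w].
  exists (e * M)%N, (ev P'), (phi D1 * u ^+ M); split.
  - exact: regular_ev.
  - apply: runitM; last exact: runitX.
    by rewrite -(evC iota x y); apply: runit_ev; rewrite ptC.
  - by rewrite ePD eD phiM phiXn phiXC ex exprMn -exprM mulrCA.
case=> N; elim: N P {P' D D0 ePD M D1 hD1 eD} P0 => [|N IH] P P0 [g [w [hg hw eN]]].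
  exists 0%N, (ev P); rewrite ?expr0 ?mul1r //; apply: runit_ev.
  apply/negP => /eqP /vanishing_dvd [g1 hg1 eP]; apply: uniformizer_nonunit.
  have [w0 _ hw'] := hw.
  have -> : (ev T)^-1 = g1 * g * w^-1.
    by apply: (mulfI evT0); rewrite !mulrA -eP eN expr0 mul1r !divff.
  by do ?apply: regularM.
have [hP|hP] := eqVneq (pt P) 0; last first.
  by exists 0%N, (ev P); rewrite ?expr0 ?mul1r //; apply: runit_ev.
have [g1 [P1 [Q1 [hQ1 eg1]]] eP] := vanishing_dvd hP.
have Q10 := pt_ev_neq0 hQ1.
have P10 : ev P1 != 0.
  by apply: contraNneq P0 => h; rewrite eP eg1 h mul0r mulr0.
have [|n [u' hu' eu']] := IH P1 P10.
  exists g, (w * ev Q1); split=> //; first by apply: runitM => //; apply: runit_ev.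
  apply: (mulfI evT0); rewrite !mulrA -exprS -eN eP eg1; field; exact: Q10.
exists n.+1, (u' / ev Q1); first by apply: runitM => //; apply/runitV/runit_ev.
by rewrite eP eg1 eu' exprS -!mulrA.
Qed.

Lemma point_decomp f : f != 0 -> exists n : int, exists2 u, runit u & f = ev T ^ n * u.
Proof.
have [_ _ hd] := hF; have [P [Q [Q0 ->]]] := hd f; rewrite !ev2E in Q0 *.
rewrite mulf_eq0 invr_eq0 negb_or => /andP [P0 _].
have [n [u hu eu]] := regular_decomp P0; have [n' [u' hu' eu']] := regular_decomp Q0.
exists (n%:Z - n'%:Z), (u / u'); first by apply: runitM => //; apply: runitV.
by rewrite expfzDr // -invr_expz -!exprnP eu eu' invfM mulrACA.
Qed.

Lemma uniformizer_place : exists2 w, is_place_valuation iota w &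
  [/\ w (ev T) = 1, w (x - iota c) = e & vge w 1 (y - iota b)].
Proof.
have [||||w hw wE] := @dvr_place _ _ iota regular (ev T) regularD regularM regular_iota.
- exact: regular_ev.
- exact: evT0.
- exact: uniformizer_nonunit.
- exact: point_decomp.
have U1 : runit 1 by rewrite -(expr0 (ev T)) -evXn; apply: runit_ev; rewrite expr0 pt1 oner_neq0.
have wT : w (ev T) = 1 by rewrite -[ev T]mulr1 -[X in X * _]expr1z wE.
exists w => //; split=> //.
  by have [u hu ->] := hx; rewrite exprnP wE.
have [g hg ->] := hy; have [->|g0] := eqVneq g 0; first by rewrite mulr0 vge0.
have [n [u hu eg]] := point_decomp g0.
rewrite (vgeMr hw) // wT subrr vgeE // eg wE //.
case: n eg => [//|n] eg; case: uniformizer_nonunit; have [_ _ hu'] := hu.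
have -> : (ev T)^-1 = g * u^-1 * ev T ^+ n.
  have [u0 _ _] := hu.
  by rewrite eg mulfK // NegzE -exprnN exprS invfM mulfVK ?expf_neq0.
by rewrite -evXn; apply: regularM; [apply: regularM | apply: regular_ev].
Qed.

End Uniformizer.

Section Centered.
Context {w : F -> int} (hw : is_place_valuation iota w)
  (wx : res iota w x c) (wy : res iota w y b).

Lemma res_phi p : res iota w (phi p) p.[c].
Proof. exact: res_poly. Qed.

Lemma res_ev P : res iota w (ev P) (pt P).
Proof.
rewrite (ev_sum _ _ _ (leqnn _)) (pt_sum _ _ (leqnn _)).
apply: (res_sum hw) => i _; apply: (resM hw); [exact: res_phi | exact: (resX hw)].
Qed.

Lemma res_regular f : regular f -> exists d, res iota w f d.
Proof.
move=> [P [Q [hQ ->]]]; exists (pt P / pt Q).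
by apply: (res_div hw) => //; apply: res_ev.
Qed.

Lemma v_runit u : runit u -> w u = 0.
Proof.
move=> [u0 /res_regular [d hd] /res_regular [d' hd']].
have := res_vge0 hw hd; have := res_vge0 hw hd'.
by rewrite !vgeE ?invr_eq0 // (vV hw) //; move: (w u) => n; clear -n; lia.
Qed.

End Centered.

End Points.

Lemma v_exprz (K F : fieldType) (iota : {rmorphism K -> F}) w
  (hw : is_place_valuation iota w) f (n : int) : f != 0 -> w (f ^ n) = w f * n.
Proof.
move=> f0; case: n => n; first by rewrite -exprnP (vX hw) // -mulr_natr natz.
by rewrite NegzE -exprnN (vV hw) ?expf_neq0 // (vX hw) // mulrN -mulr_natr natz.
Qed.

(** * Unramified and ramified points over the [x]-line *)

Section CurvePoints.
Context {K : closedFieldType} {F : fieldType} {iota : {rmorphism K -> F}}.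
Context {q m : nat} (hq : q.+1 = (3 * m)%N) (m_gt0 : (0 < m)%N) (qK : q%:R = 0 :> K).
Context {x y : F} (hF : is_function_field_X3 iota q m x y).

Local Notation phi := (phi iota x).
Local Notation ev := (ev iota x y).
Local Notation regular c b := (@regular K F iota x y c b).
Local Notation runit c b := (@runit K F iota x y c b).

Lemma y_neq b : y - iota b != 0.
Proof.
rewrite subr_eq0; apply/negP => /eqP yb.
have := curve_eq_phi hF; rewrite yb -rmorphXn -(phiC iota x) => /(phi_inj hF).
move/(congr1 (fun p : {poly K} => size p)); rewrite size_polyN.
rewrite size_mul ?expf_neq0 ?polyX_eq0 -?size_poly_eq0 ?size_XnaddC //.
by rewrite size_polyXn size_polyC /=; case: (_ != 0); case: m m_gt0 => // n; lia.
Qed.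

Section Unramified.
Context {c b : K} (c0 : c != 0) (b0 : b != 0)
  (hcb : b ^+ q.+1 + c ^+ (2 * m) + c ^+ m = 0).

Let T : {poly {poly K}} := ('X - c%:P)%:P.

Let evT : ev T = x - iota c. Proof. by rewrite evC phiXC. Qed.

Let T0 : pt c b T = 0. Proof. by rewrite ptC hornerXsubC subrr. Qed.

Let evT0 : ev T != 0. Proof. by rewrite evT (x_neq hF). Qed.

Let hx : exists2 u, runit c b u & x - iota c = ev T ^+ 1 * u.
Proof.
exists 1; last by rewrite evT expr1 mulr1.
by rewrite -(ev1 iota x y); apply: (runit_ev hq m_gt0 qK hF hcb); rewrite pt1 oner_neq0.
Qed.

Let hy : exists2 g, regular c b g & y - iota b = ev T * g.
Proof.
(* [h] is [(y^(q+1) - b^(q+1)) / (y - b)], whose value at the point is [(q + 1) b^q = b^q], a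
   nonzero element. So [y - b] is a multiple of [x - c] in the local ring. *)
pose h : {poly {poly K}} := \sum_(i < q.+1) 'X^(q - i) * (b ^+ i)%:P%:P.
have h0 : pt c b h != 0.
  rewrite ptE /h !horner_sum (eq_bigr (fun=> b ^+ q)) => [|i _].
    by rewrite sumr_const card_ord -mulr_natr -natr1 qK add0r mulr1 expf_neq0.
  rewrite hornerM hornerXn hornerC -polyC_exp -polyCM hornerC -exprD subnK //.
  by rewrite -ltnS.
have : root (- ('X^m * ('X^m + 1)) - (b ^+ q.+1)%:P) c.
  rewrite /root hornerD !hornerN hornerM hornerD hornerXn !hornerC.
  by rewrite mulrDr mulr1 -exprD addnn -mul2n -opprD oppr_eq0 addrC addrA hcb.
case/factor_theorem => p ep.
have eh : (y - iota b) * ev h = ev T * phi p.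
  rewrite evT [RHS]mulrC -(phiXC iota x) -phiM -ep phiD -(curve_eq_phi hF) phiN phiC.
  rewrite rmorphXn /= subrXX; congr (_ * _).
  rewrite /h ev_big; apply: eq_bigr => i _.
  by rewrite evM evXn evX evC phiC rmorphXn.
exists (phi p / ev h); first by exists p%:P, h; rewrite evC.
by rewrite mulrA -eh mulfK // (pt_ev_neq0 hq m_gt0 qK hF hcb).
Qed.

Lemma unramified_place : exists2 w, is_place_valuation iota w &
  w (x - iota c) = 1 /\ res iota w y b.
Proof.
have [w hw [_ h1 h2]] := uniformizer_place hq m_gt0 qK hF hcb (ltn0Sn 0) T0 evT0 hx hy.
by exists w.
Qed.

Lemma unramified_center w : is_place_valuation iota w ->
  res iota w x c -> res iota w y b ->
  w (x - iota c) = 1 /\ (forall f, f != 0 ->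
  exists2 n : int, exists2 u, runit c b u & f = (x - iota c) ^ n * u & w f = n).
Proof.
move=> hw wx wy; have xc0 := x_neq hF c.
have dec f : f != 0 -> exists n : int, exists2 u, runit c b u & f = (x - iota c) ^ n * u.
  by rewrite -evT; apply: (point_decomp hq m_gt0 qK hF hcb (ltn0Sn 0) T0 evT0 hx hy).
have wu := v_runit hw wx wy.
(* A place with this centre is zero on units of the local ring, so all its orders are multiples of
   [w (x - iota c)]; as it takes the value 1, this order is 1. *)
have w1 : w (x - iota c) = 1.
  have [_ _ _ [t [t0 wt]]] := hw; have [n [u hu et]] := dec t t0.
  have [u0 _ _] := hu; move: wt; rewrite et (vM hw) ?expfz_neq0 // (wu u hu).
  rewrite (v_exprz hw) // addr0; have := wx; rewrite /res vgeE //.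
  move: (w _) => k k1 kn; have : (k %| 1)%Z by apply/dvdzP; exists n; rewrite mulrC.
  by rewrite dvdz1; clear -k1; lia.
split=> // f /dec [n [u hu ef]]; exists n; first by exists u.
have [u0 _ _] := hu.
by rewrite ef (vM hw) ?expfz_neq0 // (v_exprz hw) // w1 mul1r (wu u hu) addr0.
Qed.

Lemma unramified_same w w' : is_place_valuation iota w -> is_place_valuation iota w' ->
  res iota w x c -> res iota w y b -> res iota w' x c -> res iota w' y b ->
  same_place w w'.
Proof.
move=> hw hw' wx wy wx' wy' f f0.
have [_ /(_ f f0) [n [u hu ef] ->]] := unramified_center hw wx wy.
have [w1 _] := unramified_center hw' wx' wy'.
have [u0 _ _] := hu.
rewrite ef (vM hw') ?expfz_neq0 ?(x_neq hF) // (v_exprz hw') ?(x_neq hF) // w1 mul1r.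
by rewrite (v_runit hw' wx' wy' hu) addr0.
Qed.

Lemma unramified_residue w f : is_place_valuation iota w ->
  res iota w x c -> res iota w y b -> vge w 0 f -> exists d, res iota w f d.
Proof.
move=> hw wx wy; have [->|f0] := eqVneq f 0.
  by exists 0; rewrite res0 vge0.
have [_ /(_ f f0) [n [u hu ef] wf]] := unramified_center hw wx wy.
rewrite vgeE // wf => n_ge0; apply: (res_regular hw wx wy).
have [_ ru _] := hu; rewrite ef; case: n n_ge0 {wf ef} => // n _.
rewrite -exprnP -evT -evXn; apply: regularM => //.
exact: regular_ev.
Qed.

End Unramified.

(** As [c] is a simple root of [X^m + 1], the equation says that [y^(q+1)] is [x - c] times a unit,
    and [y] is a local parameter. *)
Lemma ramified_place c : c ^+ m = -1 -> exists2 w, is_place_valuation iota w &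
  w (x - iota c) = q.+1 /\ w y = 1.
Proof.
move=> cm; have [k ek kc] := root_Xm hq m_gt0 qK cm.
have hc0 : 0 ^+ q.+1 + c ^+ (2 * m) + c ^+ m = 0.
  by rewrite expr0n /= add0r mulnC exprM cm sqrrN expr1n addrN.
have c0 : c != 0.
  apply/negP => /eqP c0; move: cm; rewrite c0 expr0n eqn0Ngt m_gt0 /= => /eqP.
  by rewrite eq_sym oppr_eq0 oner_eq0.
have ru : runit c 0 (phi (- ('X^m * k))).
  rewrite -(evC iota x y); apply: (runit_ev hq m_gt0 qK hF hc0); rewrite ptC.
  by rewrite hornerN hornerM hornerXn oppr_eq0 mulf_neq0 // expf_neq0.
have [w hw [h1 h2 h3]] : exists2 w, is_place_valuation iota w &
  [/\ w (ev 'X) = 1, w (x - iota c) = q.+1 & vge w 1 (y - iota 0)].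
  apply: (uniformizer_place hq m_gt0 qK hF hc0) => //.
  - by rewrite ptX.
  - by rewrite evX (y_neq0 m_gt0 hF).
  - exists (phi (- ('X^m * k)))^-1; first exact: runitV.
    rewrite evX (curve_eq_phi hF) ek mulrCA -mulrN phiM phiXC mulfK //.
    by case: ru.
  - exists 1; last by rewrite evX rmorph0 subr0 mulr1.
    by rewrite -(ev1 iota x y); apply: regular_ev.
by exists w => //; rewrite evX in h1.
Qed.

End CurvePoints.

Lemma transcendental_nonconst (K : closedFieldType) (F : fieldType)
    (iota : {rmorphism K -> F}) (t : F) : (forall c, t != iota c) ->
  forall p : {poly K}, p != 0 -> (map_poly iota p).[t] != 0.
Proof.
move=> ht p p0; have [r [_ ->]] := @map_poly_horner_prod _ _ iota p t.
rewrite mulf_neq0 ?fmorph_eq0 ?lead_coef_eq0 //.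
by rewrite prodf_seq_neq0; apply/allP => z _; rewrite subr_eq0 ht.
Qed.

Section Subfield.
Context {K F : fieldType} (iota : {rmorphism K -> F}) (x y : F).
Local Notation ev := (ev iota x y).

Definition inKxy f := exists P Q, ev Q != 0 /\ f = ev P / ev Q.

Lemma inKxyD f g : inKxy f -> inKxy g -> inKxy (f + g).
Proof.
move=> [P [Q [hQ ->]]] [P' [Q' [hQ' ->]]]; exists (P * Q' + P' * Q), (Q * Q').
by rewrite evM mulf_neq0 // evD !evM addf_div.
Qed.

Lemma inKxyM f g : inKxy f -> inKxy g -> inKxy (f * g).
Proof.
move=> [P [Q [hQ ->]]] [P' [Q' [hQ' ->]]]; exists (P * P'), (Q * Q').
by rewrite !evM mulf_neq0 // mulf_div.
Qed.

Lemma inKxyV f : inKxy f -> inKxy f^-1.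
Proof.
move=> [P [Q [hQ ->]]]; have [P0|P0] := eqVneq (ev P) 0.
  by exists 0, 1; rewrite ev1 oner_neq0 P0 mul0r invr0 ev0 mul0r.
by exists Q, P; rewrite invf_div.
Qed.

Lemma inKxy_ev P : inKxy (ev P).
Proof. by exists P, 1; rewrite ev1 oner_neq0 divr1. Qed.

Lemma inKxy_x : inKxy x.
Proof. by have := inKxy_ev 'X%:P; rewrite evC phiX. Qed.

Lemma inKxy_y : inKxy y.
Proof. by have := inKxy_ev 'X; rewrite evX. Qed.

Lemma inKxy_horner (p : {poly F}) f : (forall i, inKxy p`_i) -> inKxy f -> inKxy p.[f].
Proof.
move=> hp hf; rewrite horner_coef; elim/big_rec: _ => [|i g _ hg].
  by rewrite -(ev0 iota x y); apply: inKxy_ev.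
apply: inKxyD => //; apply: inKxyM => //.
elim: (nat_of_ord i) => [|n IH]; last by rewrite exprS; apply: inKxyM.
by rewrite expr0 -(ev1 iota x y); apply: inKxy_ev.
Qed.

Lemma inKxy_ev2 x' y' P : inKxy x' -> inKxy y' -> inKxy (ev2 iota x' y' P).
Proof.
move=> hx hy; rewrite -[ev2 _ _ _ _]/(map_poly (phi iota x') P).[y'].
apply: inKxy_horner => // i; rewrite coef_map /= phiE.
apply: inKxy_horner => // j; rewrite coef_map /=.
by rewrite -(phiC iota x) -(evC iota x y); apply: inKxy_ev.
Qed.

End Subfield.

Lemma roots_Xn_sub (K : closedFieldType) n (a : K) : n%:R != 0 :> K -> a != 0 ->
  exists2 s : seq K, uniq s & size s = n /\ forall z, z \in s -> z ^+ n = a.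
Proof.
move=> n0 a0.
have n_gt0 : (0 < n)%N by case: n n0 => //; rewrite eqxx.
have [z0 hz0] : exists z0 : K, z0 ^+ n = a.
  have /closed_rootP [z] : size ('X^n - a%:P) != 1%N by rewrite size_XnsubC // eqSS -lt0n.
  by rewrite /root !hornerE subr_eq0 => /eqP; exists z.
have z00 : z0 != 0.
  by apply: contraNneq a0 => h; rewrite -hz0 h expr0n eqn0Ngt n_gt0.
have [r er] := closed_field_poly_normal ('X^n - 1 : {poly K}).
have /monicP l1 : ('X^n - 1 : {poly K}) \is monic by rewrite -polyC1 monicXnsubC.
rewrite l1 scale1r in er.
have ur : uniq r.
  by rewrite -separable_prod_XsubC -er cyclotomic.separable_Xn_sub_1.
exists [seq z0 * z | z <- r]; first by rewrite map_inj_uniq //; apply: mulfI.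
split.
  have := congr1 (fun p : {poly K} => size p) er.
  by rewrite size_prod_XsubC -polyC1 size_XnsubC // size_map => -[].
move=> _ /mapP [z zr ->]; rewrite exprMn hz0.
have : root ('X^n - 1) z by rewrite er root_prod_XsubC.
by rewrite /root !hornerE subr_eq0 => /eqP ->; rewrite mulr1.
Qed.

Section LocalBasis.
Context {K F : fieldType} {iota : {rmorphism K -> F}} (x : F).
Local Notation phi := (phi iota x).

(* Modulo [x - c] the functions [s ^ l * t ^ j] are independent: the orders at a
   point separate the exponents [j], and the distinct residues of [s] at the points
   over [c] separate the [l] by a Vandermonde argument. *)
Lemma local_basis_vanish (c : K) (e : nat) (I : finType) (l j : I -> nat) (s t : F)
    (G : seq K) (h : I -> {poly K}) :
  uniq G -> injective (fun i => (l i, j i)) ->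
  (forall i, l i < size G)%N -> (forall i, j i < e)%N -> t != 0 ->
  (forall g, g \in G -> exists2 w, is_place_valuation iota w &
    [/\ w (x - iota c) = e, w t = 1, res iota w s g &
        vge w e (\sum_i phi (h i) * (s ^+ l i * t ^+ j i))]) ->
  x - iota c != 0 -> forall i, root (h i) c.
Proof.
move=> uG inj_lj lG je t0 hG xc0.
suff main n : (n <= e)%N -> forall i, (j i < n)%N -> root (h i) c.
  by move=> i; apply: (main e) => //.
elim: n => // n IH lt_ne; have {}IH := IH (ltnW lt_ne).
move=> i0; rewrite ltnS leq_eqVlt => /orP [/eqP ji0|]; last exact: IH.
(* [p] gathers the terms in [t^n], specialised at [c]. All other terms have order above [n], so [p]
   vanishes at every element of [G], and these outnumber its degree. *)
pose p := \sum_(i | j i == n) (h i).[c] *: 'X^(l i).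
suff p0 : p = 0.
  have := congr1 (fun p : {poly K} => p`_(l i0)) p0.
  rewrite coef0 coef_sum (bigD1 i0) ?ji0 //= coefZ coefXn eqxx mulr1.
  rewrite big1 ?addr0 => [/eqP //|i /andP [/eqP ji ii0]].
  rewrite coefZ coefXn; case: eqP => [ll|_]; last by rewrite mulr0.
  by case/eqP: ii0; apply: inj_lj; rewrite /= -ll ji ji0.
apply: (@roots_geq_poly_eq0 _ p G) => //; last first.
  apply: (leq_trans (size_sum _ _ _)); apply/bigmax_leqP => i _.
  by apply: leq_trans (size_scale_leq _ _) _; rewrite size_polyXn.
apply/allP => g /hG [w hw [wx wt ws wsum]].
have ws0 := res_vge0 hw ws.
have wphi r : res iota w (phi r) r.[c].
  by apply: (res_poly hw); rewrite /res vgeE // wx; move: lt_ne; clear; lia.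
have wtX (k : nat) : vge w k (t ^+ k).
  by rewrite vgeE ?expf_neq0 // (vX hw) // wt -[(_ *+ k)%R]/(1 *+ k) natz.
have le_nS k : (n < k)%N -> forall f, vge w k f -> vge w (n.+1%:Z) f.
  by move=> ltk f; apply: vgeW; rewrite lez_nat.
have wrest : vge w n.+1 (\sum_(i | j i != n) phi (h i) * (s ^+ l i * t ^+ j i)).
  apply: (vge_sum hw) => i; rewrite neq_ltn => /orP [lt_jn|lt_nj].
    have /factor_theorem [r ->] := IH i lt_jn.
    rewrite phiM phiXC mulrAC -mulrA; apply: (le_nS _ lt_ne).
    apply: (vge0M hw); first exact: res_vge0 (wphi r).
    apply: (vge0M hw); last by rewrite vgeE ?wx.
    by apply: (vge0M hw); [apply: (vge0X hw) | apply: vgeW (wtX _)].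
  apply: (le_nS _ lt_nj); apply: (vge0M hw); first exact: res_vge0 (wphi _).
  by apply: (vge0M hw) => //; apply: (vge0X hw).
have : vge w n.+1 ((\sum_(i | j i == n) phi (h i) * s ^+ l i) * t ^+ n).
  rewrite mulr_suml (eq_bigr (fun i => phi (h i) * (s ^+ l i * t ^+ j i))).
    move: wsum; rewrite (bigID (fun i => j i == n)) /= => wsum.
    have := vgeB hw (le_nS _ lt_ne _ wsum) wrest.
    by rewrite addrK.
  by move=> i /eqP ->; rewrite mulrA.
rewrite mulrC (vgeMr hw) ?expf_neq0 // (vX hw) // wt natz.
have -> : n.+1%:Z - n%:Z = 1 by lia.
rewrite -(res0 (iota := iota)) /p.
have wG : res iota w (\sum_(i | j i == n) phi (h i) * s ^+ l i) p.[g].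
  rewrite /p horner_sum; apply: (res_sum hw) => i _; rewrite hornerZ hornerXn.
  by apply: (resM hw) => //; apply: (resX hw).
by move=> /(res_uniq hw wG) /eqP.
Qed.

End LocalBasis.

(** * Charts and the Kummer basis *)

Section Charts.
Context {K : closedFieldType} {F : fieldType} {iota : {rmorphism K -> F}}.
Context {q m : nat} (hq : q.+1 = (3 * m)%N) (m_gt0 : (0 < m)%N) (qK : q%:R = 0 :> K).

(** Points where [x] vanishes or has a pole are treated as affine points for another pair of
    generators with the same equation. *)
Lemma function_field_chart x y x' y' : is_function_field_X3 iota q m x y ->
  (forall c, x' != iota c) -> y' ^+ q.+1 + x' ^+ (2 * m) + x' ^+ m = 0 ->
  inKxy iota x' y' x -> inKxy iota x' y' y -> is_function_field_X3 iota q m x' y'.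
Proof.
move=> [_ _ hd] hx' h' hx hy; split=> //; first exact: transcendental_nonconst.
move=> f; have [P [Q [_ ->]]] := hd f.
by apply: inKxyM; [apply: inKxy_ev2 | apply/inKxyV/inKxy_ev2].
Qed.

Context {x y : F} (hF : is_function_field_X3 iota q m x y).
Local Notation phi := (phi iota x).
Local Notation z := (y ^+ 3 / x).

Lemma zX_eq : z ^+ m = - (x ^+ m + 1).
Proof.
rewrite exprMn -exprM -hq (curve_eq_phi hF) phiN phiM phiD phiXn phiX phi1 exprVn.
by rewrite mulNr mulrAC divff ?mul1r // expf_neq0 // (x_neq0 hF).
Qed.

Lemma z_neq c : z != iota c.
Proof.
apply/negP => /eqP zc; have := zX_eq; rewrite zc -rmorphXn -(phiC iota x).
have -> : - (x ^+ m + 1) = phi (- ('X^m + 1)) by rewrite phiN phiD phiXn phiX phi1.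
move=> /(phi_inj hF).
move/(congr1 (fun p : {poly K} => size p)); rewrite size_polyN size_XnaddC //.
by rewrite size_polyC; case: (_ != 0) => //; case: m m_gt0.
Qed.

(** By [zX_eq], [z^m (z^m + 1) = x^m (x^m + 1)], and [x = y^3 / z]: the roles of [x] and [z] are
    symmetric. *)
Lemma chart_z : is_function_field_X3 iota q m z y.
Proof.
have x0 := x_neq0 hF; have y0 := y_neq0 m_gt0 hF.
have [Kz Ky] := (inKxy_x iota z y, inKxy_y iota z y).
apply: (function_field_chart hF z_neq) => //.
  rewrite mulnC exprM zX_eq sqrrN (curve_eq hF) mulnC exprM; ring.
have e : y * y * y / z = x by field; rewrite x0 y0.
suff : inKxy iota z y (y * y * y / z) by rewrite e.
by apply: inKxyM; [do 2 apply: inKxyM => // | apply: inKxyV].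
Qed.

(** Dividing the equation by [x^(3 m)] exchanges the terms of exponents [2 m] and [m]. *)
Lemma chart_inf : is_function_field_X3 iota q m x^-1 (y / x).
Proof.
have x0 := x_neq0 hF.
have Kx : inKxy iota x^-1 (y / x) x.
  by rewrite -{3}[x]invrK; apply/inKxyV/inKxy_x.
apply: (function_field_chart hF) => //.
- move=> c; apply/negP => /eqP e; have := x_neq hF c^-1.
  by rewrite fmorphV -e invrK subrr eqxx.
- rewrite exprMn (curve_eq hF) !exprVn hq.
  have -> : (3 * m = m + (2 * m))%N by lia.
  rewrite exprD mulnC exprM; set X := x ^+ m.
  have X0 : X != 0 by rewrite expf_neq0.
  by field.
- suff : inKxy iota x^-1 (y / x) ((y / x) * x) by rewrite divfK.
  by apply: inKxyM => //; apply: inKxy_y.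
Qed.

Lemma place_regular_y w : is_place_valuation iota w -> vge w 0 x -> vge w 0 y.
Proof.
move=> hw wx; apply: (@vgeX_inv _ _ iota _ hw _ q.+1) => //.
by rewrite (curve_eq_phi hF); apply: (vge_poly hw).
Qed.

Lemma place_center w : is_place_valuation iota w -> vge w 0 x ->
  exists c b, [/\ b ^+ q.+1 + c ^+ (2 * m) + c ^+ m = 0, res iota w x c & res iota w y b].
Proof.
move=> hw wx; have wy := place_regular_y hw wx.
have wev P : vge w 0 (ev iota x y P).
  apply: (vge_horner hw) => // i; rewrite coef_map /=; exact: (vge_poly hw).
have [c xc] : exists c, res iota w x c.
  (* A function of order 1 is a quotient [P / Q], so [P] has positive order, and so has a nonzero
     polynomial in [x] that is a multiple of [P]. One of its roots is the residue of [x]. *)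
  have [_ _ _ [t [t0 wt]]] := hw; have [_ _ hd] := hF.
  have [P [Q [Q0 et]]] := hd t; rewrite !ev2E in Q0 et.
  have P0 : ev iota x y P != 0 by apply: contraNneq t0 => h; rewrite et h mul0r.
  have [P' [D [D0 eD]]] := norm_ev hF P0.
  have [|c _ xc] := residue_root hw D0 wx; last by exists c.
  rewrite -(phiE iota x D) -eD; apply: (vgeM0 hw) => //.
  have -> : ev iota x y P = ev iota x y Q * t by rewrite et mulrC divfK.
  by apply: (vge0M hw) => //; rewrite vgeE ?wt.
pose k := (- ('X^m * ('X^m + 1)) : {poly K}).[c].
have [||b rb yb] := @residue_root _ _ _ _ hw ('X^(q.+1) - k%:P) y _ wy.
- by rewrite -size_poly_eq0 size_XnsubC.
- rewrite rmorphB /= map_polyXn map_polyC hornerD hornerN hornerXn hornerC.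
  by rewrite (curve_eq_phi hF); apply: (res_poly hw).
exists c, b; split=> //; move: rb; rewrite /root hornerD hornerN hornerXn hornerC.
rewrite subr_eq0 => /eqP ->; rewrite /k hornerN hornerM hornerD hornerXn hornerC.
by rewrite mulnC exprM; ring.
Qed.

(** The points over [x = 0] are ramified points of the chart [(z, y)]: there [y] is a local
    parameter, [z] is a unit, and [x = y^3 / z]. *)
Lemma fiber_zero_place g : g ^+ m = -1 -> exists2 w, is_place_valuation iota w &
  [/\ w x = 3, w y = 1 & res iota w z g].
Proof.
move=> hg; have [w hw [wz wy]] := ramified_place hq m_gt0 qK chart_z hg.
have x0 := x_neq0 hF; have y0 := y_neq0 m_gt0 hF.
have zg : res iota w z g by rewrite /res vgeE ?wz // (x_neq chart_z).
have g0 : g != 0.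
  apply/negP => /eqP g0; move: hg; rewrite g0 expr0n eqn0Ngt m_gt0 /= => /eqP.
  by rewrite eq_sym oppr_eq0 oner_eq0.
have [z0 wz0] := res_unit hw zg g0.
exists w => //; split=> //.
have -> : x = y ^+ 3 / z by field; rewrite x0 y0.
by rewrite (vM hw) ?invr_eq0 ?expf_neq0 // (vV hw) // wz0 (vX hw) // wy.
Qed.

(** The Kummer basis, indexed so that element [r] is [y^r / x^(r %/ 3)]. Where [x] has order 3 and
    [y] order 1, it has order [r %% 3]. *)
Definition kbasis (r : nat) : F := z ^+ (r %/ 3) * y ^+ (r %% 3).

Lemma kbasisE r : x ^+ (r %/ 3) * kbasis r = y ^+ r.
Proof.
rewrite /kbasis mulrA -exprMn [x * _]mulrC divfK ?(x_neq0 hF) //.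
by rewrite -exprM -exprD mulnC -divn_eq.
Qed.

Lemma kbasis_span f : exists D (h : 'I_(3 * m) -> {poly K}), D != 0 /\
  phi D * f = \sum_r phi (h r) * kbasis r.
Proof.
have [_ _ hd] := hF; have [P [Q [Q0 ->]]] := hd f; rewrite !ev2E in Q0 *.
have [Q' [D [D0 eD]]] := norm_ev hF Q0.
have [C [R [eR sR]]] := @reduce_curve K q m (P * Q').
exists D, (fun r => R`_r * 'X^(r %/ 3)); split=> //.
have -> : phi D * (ev iota x y P / ev iota x y Q) = ev iota x y R.
  have : ev iota x y (P * Q') = ev iota x y R.
    by rewrite eR evD evM (ev_curve hF) mulr0 add0r.
  by rewrite -eD evM => <-; field.
rewrite (@ev_sum _ _ _ _ _ _ (3 * m)) -?hq //; apply: eq_bigr => r _.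
by rewrite phiM phiXn phiX -mulrA kbasisE.
Qed.

End Charts.

(** * Regular functions on the affine curve and their degrees *)

Section Normality.
Context {K : closedFieldType} {F : fieldType} {iota : {rmorphism K -> F}}.
Context {q m : nat} (hq : q.+1 = (3 * m)%N) (m_gt0 : (0 < m)%N) (qK : q%:R = 0 :> K).

Section Fibers.
Context {x y : F} (hF : is_function_field_X3 iota q m x y).
Local Notation phi := (phi iota x).
Local Notation kb := (@kbasis F x y).

Lemma ltn_div3 (r : 'I_(3 * m)) : (r %/ 3 < m)%N.
Proof. by rewrite ltn_divLR // (leq_trans (ltn_ord r)) // mulnC. Qed.

(** The fibre over [c] provides [m] points of index 3 if [c = 0], one point of index [q + 1] if
    [c^m = -1], and [q + 1] unramified points otherwise. In each case these suffice for
    [local_basis_vanish]. *)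
Lemma fiber_root c (h : 'I_(3 * m) -> {poly K}) :
  (forall w, is_place_valuation iota w -> res iota w x c ->
     vge w (w (x - iota c)) (\sum_r phi (h r) * kb r)) ->
  forall r, root (h r) c.
Proof.
set f := \sum_r _ => hf; have xc0 := x_neq hF c.
have x0 := x_neq0 hF; have y0 := y_neq0 m_gt0 hF.
have m1 : (-1 : K) != 0 by rewrite oppr_eq0 oner_neq0.
have [c0|c0] := eqVneq c 0.
  have [G uG [sG hG]] := roots_Xn_sub (mK hq qK) m1.
  apply: (@local_basis_vanish _ _ iota x c 3 _ (fun r : 'I_(3 * m) => r %/ 3)%N
    (fun r => r %% 3)%N (y ^+ 3 / x) y G) => //.
  - move=> r r' [e1 e2]; apply: ord_inj.
    by rewrite (divn_eq r 3) e1 e2 -divn_eq.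
  - by move=> r; rewrite sG ltn_div3.
  - by move=> r; rewrite ltn_mod.
  move=> g /hG /(fiber_zero_place hq m_gt0 qK hF) [w hw [wx wy wz]].
  have xE : x - iota c = x by rewrite c0 rmorph0 subr0.
  exists w => //; split; rewrite ?xE //.
  by have := hf w hw; rewrite /res xE wx vgeE // wx => /(_ isT).
(* For nonzero [c], [x] is a unit on the fibre, and multiplication by [x^m] allows powers of [y] to
   replace the Kummer basis. *)
pose h' (r : 'I_(3 * m)) := h r * 'X^(m - r %/ 3).
suff hh' r : root (h' r) c.
  by move=> r; have := hh' r; rewrite rootM /root horner_exp hornerX expf_eq0 (negbTE c0) andbF orbF.
have ef : f * x ^+ m = \sum_r phi (h' r) * y ^+ r.
  rewrite /f mulr_suml; apply: eq_bigr => r' _.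
  rewrite -(kbasisE hF) /h' phiM phiXn phiX.
  have -> : x ^+ m = x ^+ (m - r' %/ 3) * x ^+ (r' %/ 3).
    by rewrite -exprD subnK // ltnW // ltn_div3.
  by ring.
have hf' w : is_place_valuation iota w -> res iota w x c ->
    vge w (w (x - iota c)) (\sum_r phi (h' r) * y ^+ r).
  move=> hw wx; rewrite -ef; apply: (vgeM0 hw); first exact: hf.
  by apply/(vge0X hw)/(res_vge0 hw wx).
have [cm|cm] := eqVneq (c ^+ m) (-1).
  move: r; apply: (@local_basis_vanish _ _ iota x c (3 * m) _ (fun=> 0%N)
    (fun r : 'I_(3 * m) => r) 1 y [:: 1]) => //; first by move=> r r' [/ord_inj].
  move=> _ /[!inE] /eqP ->.
  have [w hw [wx wy]] := ramified_place hq m_gt0 qK hF cm.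
  rewrite hq in wx; exists w => //; split; rewrite ?wx //; first exact: res1.
  have := hf' w hw; rewrite /res vgeE // wx lez_nat muln_gt0 /= => /(_ m_gt0) hs.
  rewrite (eq_bigr (fun i : 'I_(3 * m) => phi (h' i) * y ^+ i)) // => i _.
  by rewrite expr1n mul1r.
have q1 : q.+1%:R != 0 :> K by rewrite -natr1 qK add0r oner_neq0.
have k0 : - (c ^+ (2 * m) + c ^+ m) != 0.
  rewrite oppr_eq0 mulnC exprM expr2 -[X in _ + X]mul1r -mulrDl mulf_neq0 ?expf_neq0 //.
  by rewrite addr_eq0.
have [G uG [sG hG]] := roots_Xn_sub q1 k0.
move: r; apply: (@local_basis_vanish _ _ iota x c 1 _ (fun r : 'I_(3 * m) => r)
    (fun=> 0%N) y (x - iota c) G) => //; first by move=> r r' [/ord_inj].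
  by move=> r; rewrite sG hq.
move=> g /hG eg.
have hcg : g ^+ q.+1 + c ^+ (2 * m) + c ^+ m = 0 by rewrite eg -addrA addNr.
have g0 : g != 0 by apply: contraNneq k0 => h0; rewrite -eg h0 expr0n.
have [w hw [wx wy]] := unramified_place hq m_gt0 qK hF g0 hcg.
exists w => //; split => //.
have := hf' w hw; rewrite /res vgeE // wx => /(_ isT) hs.
rewrite (eq_bigr (fun i : 'I_(3 * m) => phi (h' i) * y ^+ i)) // => i _.
by rewrite expr0 mulr1.
Qed.

(** A denominator in [K[x]] is removed one linear factor at a time: at a root [c] of it the
    numerator vanishes along the fibre, so [X - c] divides all coefficients. *)
Lemma finite_normality f :
  (forall w, is_place_valuation iota w -> vge w 0 x -> vge w 0 f) ->
  exists h : 'I_(3 * m) -> {poly K}, f = \sum_r phi (h r) * kb r.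
Proof.
move=> hf; have [D [h [D0 ef]]] := kbasis_span hq hF f.
have [n] := ubnP (size D); elim: n D h D0 ef => // n IH D h D0 ef sD.
have [sD1|/closed_rootP [c]] := eqVneq (size D) 1%N.
  have [d d0 eD] := size_poly1P D (eqbLR (erefl _) (introT eqP sD1)).
  exists (fun r => (d^-1)%:P * h r).
  rewrite (eq_bigr (fun r => iota d^-1 * (phi (h r) * kb r))).
    rewrite -mulr_sumr -ef eD phiC mulrA -rmorphM mulVf //.
    by rewrite rmorph1 mul1r.
  by move=> r _; rewrite phiM phiC mulrA.
case/factor_theorem => D' eD; have xc0 := x_neq hF c.
have D'0 : D' != 0 by apply: contraNneq D0 => h0; rewrite eD h0 mul0r.
have rh r : root (h r) c.
  apply: fiber_root => w hw wx; rewrite -ef eD phiM phiXC.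
  apply: (vgeM0 hw); last by apply: hf => //; apply: res_vge0 wx.
  by apply: (vge0M hw); [apply: (vge_poly hw _ (res_vge0 hw wx)) | rewrite vgeE].
apply: (IH D' (fun r => h r %/ ('X - c%:P))) => //.
  apply: (mulfI xc0); rewrite mulrA -(phiXC iota x) -phiM [_ * D']mulrC -eD ef mulr_sumr.
  apply: eq_bigr => r _; rewrite [RHS]mulrA -phiM; congr (phi _ * _).
  by rewrite mulrC divpK // dvdp_XsubCl.
by move: sD; rewrite eD size_mul ?polyXsubC_eq0 // size_XsubC addn2.
Qed.

End Fibers.

Context {x y : F} (hF : is_function_field_X3 iota q m x y).
Local Notation phix := (phi iota x).
Local Notation kb := (@kbasis F x y).

(** The degree of the monomial [z^l y^j], which is also the power of [x] that carries it to the
    chart at infinity. *)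
Definition kdeg (r : nat) := (r %/ 3 + r %% 3)%N.

Lemma kbasis_inf r : x^-1 ^+ kdeg r * kb r = @kbasis F x^-1 (y / x) r.
Proof.
have x0 := x_neq0 hF; rewrite /kbasis /kdeg exprD mulrACA -!exprMn.
have -> : x^-1 * (y ^+ 3 / x) = (y / x) ^+ 3 / x^-1 by rewrite invrK; field.
by rewrite [x^-1 * y]mulrC.
Qed.

Lemma phi_reverse (p : {poly K}) M : (size p <= M.+1)%N ->
  phix p * x^-1 ^+ M = phi iota x^-1 (\poly_(i < M.+1) p`_(M - i)).
Proof.
have x0 := x_neq0 hF; move=> sp; rewrite !phiE.
rewrite (@horner_coef_wide _ M.+1 (map_poly _ p)) ?size_map_poly //.
rewrite (@horner_coef_wide _ M.+1) ?size_map_poly ?size_poly //.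
rewrite mulr_suml [RHS](reindex_inj rev_ord_inj); apply: eq_bigr => i _ /=.
have le_iM : (i <= M)%N by rewrite -ltnS.
rewrite !coef_map /= coef_poly subSS ltnS leq_subr subKn //.
have -> : x^-1 ^+ M = x^-1 ^+ i * x^-1 ^+ (M - i) by rewrite -exprD subnKC.
by rewrite mulrA -[iota _ * _ * _]mulrA -exprMn divff // expr1n mulr1.
Qed.

(* The reversal [X^(N - kdeg r) h_r(1/X)] expresses the coefficients in the chart at
   infinity, so vanishing there removes the terms of top total degree [N]. *)
Lemma degree_bound k (h : 'I_(3 * m) -> {poly K}) :
  (forall w, is_place_valuation iota w -> w x < 0 ->
     vge w (k%:Z * w x) (\sum_r phix (h r) * kb r)) ->
  forall (r : 'I_(3 * m)) i, (k < i + kdeg r)%N -> (h r)`_i = 0.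
Proof.
move=> hf; have x0 := x_neq0 hF.
pose bounded N := forall (r : 'I_(3 * m)) i, (N < i + kdeg r)%N -> (h r)`_i = 0.
(* The bound descends by one at a time, starting from a crude bound on all degrees. *)
suff step N : (k <= N)%N -> bounded N -> bounded k.
  pose M := (\max_(r < 3 * m) (size (h r) + kdeg r))%N.
  have hM (r : 'I_(3 * m)) : (size (h r) + kdeg r <= M)%N.
    exact: (leq_bigmax (F := fun r : 'I_(3 * m) => size (h r) + kdeg r)%N).
  apply: (step (k + M)%N); first exact: leq_addr.
  move=> r i ltN; apply: nth_default; move: ltN (hM r); move: (size _) => s.
  by clear; lia.
elim: N => [|N IH]; first by rewrite leqn0 => /eqP ->.
rewrite leq_eqVlt => /orP [/eqP -> //|lt_kN bN]; apply: IH => //.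
pose h1 (r : 'I_(3 * m)) := \poly_(i < (N.+1 - kdeg r).+1) (h r)`_(N.+1 - kdeg r - i).
have eh r : phix (h r) * x^-1 ^+ (N.+1 - kdeg r) = phi iota x^-1 (h1 r).
  apply: phi_reverse => //; apply/leq_sizeP => i lt_i; apply: bN.
  by move: lt_i; clear; lia.
have ef : (\sum_r phix (h r) * kb r) * x^-1 ^+ N.+1 =
    \sum_r phi iota x^-1 (h1 r) * @kbasis F x^-1 (y / x) r.
  rewrite mulr_suml; apply: eq_bigr => r _; rewrite -eh -kbasis_inf.
  have [le_dN|lt_Nd] := leqP (kdeg r) N.+1.
    by rewrite -{1}(subnK le_dN) exprD; ring.
  have -> : h r = 0; last by rewrite phi0 !mul0r.
  by apply/polyP => i; rewrite coef0; apply: bN; rewrite ltn_addl.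
have rh1 r : root (h1 r) 0.
  apply: (fiber_root (chart_inf hq m_gt0 hF)) => w hw wx1.
  have ex : x^-1 - iota 0 = x^-1 by rewrite rmorph0 subr0.
  have wx : w x < 0.
    by move: wx1; rewrite /res ex vgeE ?invr_eq0 // (vV hw) //; clear; lia.
  rewrite ex -ef mulrC (vgeMr hw) ?expf_neq0 ?invr_eq0 // (vX hw) ?invr_eq0 //.
  rewrite (vV hw) //; apply: vgeW (hf w hw wx).
  by rewrite -mulr_natr; move: lt_kN wx; clear; nia.
move=> r i; rewrite leq_eqVlt => /orP [/eqP eN|]; last exact: bN.
have := rh1 r; rewrite /root horner_coef0 coef_poly /= subn0 => /eqP.
by have -> : (N.+1 - kdeg r = i)%N by lia.
Qed.

End Normality.

(** * The tangent cubic *)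

Section Cubic.
Context {L : fieldType} (X Y Z : L) (XZ : X * Z = Y ^+ 3) (Y1 : 1 - Y != 0).

(** For [X = u^3], [Y = u w], [Z = w^3] this is the product of the three lines
    [zeta^i u + zeta^(-i) w + 1]. *)
Definition cubic_lam := X + Z + 1 - 3%:R * Y.
(** At the point [(t^3, - t - t^2)] of the cubic, [X - Y = t (1 + t + t^2)] and
    [1 - Y = 1 + t + t^2], so this recovers the parameter [t]. *)
Definition cubic_tau := (X - Y) / (1 - Y).
Definition cubic_eps := X / (1 - Y) ^+ 2.

Let lam_eps : cubic_lam * cubic_eps = (X ^+ 2 + Y ^+ 3 + X - 3%:R * X * Y) / (1 - Y) ^+ 2.
Proof. by rewrite -XZ /cubic_lam /cubic_eps; field. Qed.

Lemma cubic_Y : Y = - cubic_tau - cubic_tau ^+ 2 + cubic_lam * cubic_eps.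
Proof. by rewrite lam_eps /cubic_tau; field. Qed.

Lemma cubic_X : X = cubic_tau ^+ 3 + cubic_lam * ((1 - cubic_tau) * cubic_eps).
Proof. by rewrite [_ * cubic_eps]mulrC mulrA lam_eps /cubic_tau; field. Qed.

Lemma cubic_Z : Z = - (1 + cubic_tau) ^+ 3 + cubic_lam * (1 + (2%:R + cubic_tau) * cubic_eps).
Proof.
have -> : cubic_lam * (1 + (2%:R + cubic_tau) * cubic_eps) = X + Z + 1 - 3%:R * Y + (2%:R + cubic_tau) * (cubic_lam * cubic_eps).
  by rewrite /cubic_lam; ring.
by rewrite lam_eps /cubic_tau; field.
Qed.

Context {q m : nat} (hq : q.+1 = (3 * m)%N) (S : L)
  (frob : forall u w : L, (u + w) ^+ q = u ^+ q + w ^+ q)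
  (q_gt0 : (0 < q)%N)
  (curve : X ^+ m * (1 + S) - Z ^+ m * S + S * (1 + S) = 0).

(** Additivity of the Frobenius map gives [(-1)^(q+1) = 1], and [q + 1 = 3 m] has the parity of
    [m]. *)
Lemma frob_signN1 : (-1 : L) ^+ m = 1.
Proof.
have : (-1 : L) ^+ q.+1 = 1.
  have := frob 1 (-1); rewrite subrr expr0n eqn0Ngt q_gt0 expr1n /= => /esym/eqP.
  by rewrite addrC addr_eq0 exprS => /eqP ->; rewrite mulrNN mulr1.
by rewrite hq exprM -signr_odd /= expr1.
Qed.

(** Replacing [X] by [tau^3] and [Z] by [- (1 + tau)^3] in [curve] changes it by a multiple of
    [lam], with this cofactor. The sums come from factoring differences of [m]-th powers. *)
Definition tangent_cofactor :=
  S * (1 + (2%:R + cubic_tau) * cubic_eps) *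
    (\sum_(i < m) Z ^+ (m.-1 - i) * (- (1 + cubic_tau) ^+ 3) ^+ i)
  - (1 + S) * ((1 - cubic_tau) * cubic_eps) * (\sum_(i < m) X ^+ (m.-1 - i) * (cubic_tau ^+ 3) ^+ i).

(* On the tangent line, with parameter [tau], the equation of the curve becomes
   [(tau - S) (tau ^ q - S)]. *)
Lemma curve_tau : (cubic_tau - S) * (cubic_tau ^+ q - S) = cubic_lam * tangent_cofactor.
Proof.
have eX : cubic_lam * ((1 - cubic_tau) * cubic_eps) = X - cubic_tau ^+ 3 by rewrite [in RHS]cubic_X; ring.
have eZ : cubic_lam * (1 + (2%:R + cubic_tau) * cubic_eps) = Z - - (1 + cubic_tau) ^+ 3.
  by rewrite [in RHS]cubic_Z; ring.
rewrite /tangent_cofactor.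
set MZ := \sum_(i < m) _ * (- _) ^+ _; set MX := \sum_(i < m) _.
have -> : cubic_lam * (S * (1 + (2%:R + cubic_tau) * cubic_eps) * MZ - (1 + S) * ((1 - cubic_tau) * cubic_eps) * MX) =
   S * (cubic_lam * (1 + (2%:R + cubic_tau) * cubic_eps) * MZ) - (1 + S) * (cubic_lam * ((1 - cubic_tau) * cubic_eps) * MX).
  by ring.
have sg (u : L) : (- u) ^+ m = u ^+ m by rewrite exprNn frob_signN1 mul1r.
(* After the substitution [X^m] is [tau^(q+1)] and [Z^m] is [(1 + tau) (1 + tau^q)]; the terms
   regroup as [(tau - S) (tau^q - S)]. *)
rewrite eX eZ -!subrXX sg -!exprM -hq ![_ ^+ q.+1]exprS.
rewrite frob expr1n; apply/eqP; rewrite -subr_eq0 -[X in _ == X]curve; apply/eqP; ring.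
Qed.

End Cubic.

(** * Congruences at a place, and polynomials on the nodal cubic *)

Section Congruence.
Context {K F : fieldType} {iota : {rmorphism K -> F}} {w : F -> int}
  (hw : is_place_valuation iota w) (n : int).

Lemma vge_congM f f' g g' : vge w 0 g -> vge w 0 f' ->
  vge w n (f - f') -> vge w n (g - g') -> vge w n (f * g - f' * g').
Proof.
move=> hg hf' h h'; have -> : f * g - f' * g' = (f - f') * g + f' * (g - g') by ring.
by apply: (vgeD hw); [apply: (vgeM0 hw) | apply: (vge0M hw)].
Qed.

Lemma vge_congX f f' k : vge w 0 f -> vge w 0 f' ->
  vge w n (f - f') -> vge w n (f ^+ k - f' ^+ k).
Proof.
move=> hf hf' h; rewrite subrXX; apply: (vgeM0 hw) => //.
by apply: (vge_sum hw) => i _; apply: (vge0M hw); apply: (vge0X hw).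
Qed.

Lemma vge_congD f f' g g' :
  vge w n (f - f') -> vge w n (g - g') -> vge w n (f + g - (f' + g')).
Proof. by rewrite opprD addrACA; apply: (vgeD hw). Qed.

Lemma vge_cong_poly (p : {poly K}) f f' : vge w 0 f -> vge w 0 f' ->
  vge w n (f - f') -> vge w n ((map_poly iota p).[f] - (map_poly iota p).[f']).
Proof.
move=> hf hf' h; rewrite !horner_coef -sumrB; apply: (vge_sum hw) => i _.
rewrite -mulrBr; apply: (vge0M hw); last exact: vge_congX.
by rewrite coef_map; apply: vge_iota.
Qed.

End Congruence.

Lemma vge_poly_pole (K F : fieldType) (iota : {rmorphism K -> F}) w
    (hw : is_place_valuation iota w) (p : {poly K}) f (c : int) k :
  c <= 0 -> vge w c f -> (size p <= k.+1)%N -> vge w (c * k%:Z) (map_poly iota p).[f].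
Proof.
move=> c0 hf sp; rewrite (@horner_coef_wide _ k.+1) ?size_map_poly //.
apply: (vge_sum hw) => i _; apply: (vge0M hw); first by rewrite coef_map; apply: vge_iota.
apply: vgeW (vgeX hw i hf).
by rewrite -mulr_natr natz; move: (ltn_ord i); rewrite ltnS; move: (nat_of_ord i) c0;
   clear => i c0; nia.
Qed.

(** Induction on the pole order: the residue of [f] times the matching power of [l] is the leading
    coefficient of the polar part, and its term is subtracted. *)
Lemma polar_part (K F : fieldType) (iota : {rmorphism K -> F}) w
    (hw : is_place_valuation iota w) (l : F) : l != 0 -> w l = 1 ->
  (forall f, vge w 0 f -> exists d, res iota w f d) ->
  forall r f, vge w (- r%:Z) f -> exists p : {poly K}, (size p <= r.+1)%N /\
    vge w 0 (f - (map_poly iota p).[l^-1]).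
Proof.
move=> l0 wl hres; elim=> [|r IH] f hf.
  by exists 0; rewrite size_poly0 rmorph0 horner0 subr0 -oppr0.
have [|d rd] := hres (f * l ^+ r.+1).
  rewrite mulrC (vgeMr hw) ?expf_neq0 // (vX hw) // wl.
  by apply: vgeW hf; rewrite -mulr_natr natz; lia.
have lr0 : l ^+ r.+1 != 0 by rewrite expf_neq0.
have [|p [sp hp]] := IH (f - iota d * l^-1 ^+ r.+1).
  have -> : f - iota d * l^-1 ^+ r.+1 = l^-1 ^+ r.+1 * (f * l ^+ r.+1 - iota d).
    by rewrite exprVn; field.
  rewrite (vgeMr hw) ?expf_neq0 ?invr_eq0 // (vX hw) ?invr_eq0 // (vV hw) // wl.
  by apply: vgeW rd; rewrite -mulr_natr natz; lia.
exists (p + d *: 'X^(r.+1)); split.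
  apply: (leq_trans (size_polyD _ _)); rewrite geq_max (leq_trans sp) //=.
  by apply: (leq_trans (size_scale_leq _ _)); rewrite size_polyXn.
rewrite rmorphD /= linearZ /= map_polyXn hornerD hornerZ hornerXn.
by rewrite opprD addrA addrAC.
Qed.

Lemma poly_mod3 (K : fieldType) k (g : {poly K}) : (size g <= (3 * k).+1)%N ->
  exists A B C : {poly K}, [/\ (size A <= k.+1)%N, (size B <= k)%N, (size C <= k)%N &
    g = A \Po 'X^3 + 'X * (B \Po 'X^3) + 'X^2 * (C \Po 'X^3)].
Proof.
elim: k g => [|k IH] g sg.
  exists g, 0, 0; rewrite size_poly0 !comp_poly0 !mulr0 !addr0; split=> //.
  by have [c ->] : exists c, g = c%:P; [exists g`_0; apply: size1_polyC | rewrite comp_polyC].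
have [|A [B [C [sA sB sC eg]]]] := IH (drop_poly 3 g).
  by rewrite size_drop_poly; move: sg; clear; lia.
exists (A * 'X + (g`_0)%:P), (B * 'X + (g`_1)%:P), (C * 'X + (g`_2)%:P).
have sX (p : {poly K}) c n : (size p <= n)%N -> (size (p * 'X + c%:P)%R <= n.+1)%N.
  by move=> sp; rewrite size_MXaddC; case: ifP.
split; try exact: sX.
rewrite !(comp_polyD, comp_polyM, comp_polyX, comp_polyC).
rewrite -[LHS](poly_take_drop 3 g) eg.
have -> : take_poly 3 g = (g`_0)%:P + 'X * (g`_1)%:P + 'X^2 * (g`_2)%:P.
  apply/polyP => i; rewrite coef_take_poly !coefD coefXM coefXnM !coefC.
  by case: i => [|[|[|i]]] //=; rewrite ?subn0 ?addr0 ?add0r.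
by ring.
Qed.

(* The normalisation of the nodal cubic [X + Z + 1 = 3 Y, X Z = Y ^ 3] identifies the
   parameters [z] and [z ^ 2]; this is the only condition on its regular functions. *)
Lemma nodal_restriction (K : fieldType) (z : K) k (g : {poly K}) :
  z ^+ 3 = 1 -> z != z ^+ 2 -> (size g <= (3 * k).+1)%N -> g.[z] = g.[z ^+ 2] ->
  exists h0 h1 h2 : {poly K}, [/\ (size h0 <= k.+1)%N, (size h1 <= k)%N,
    (size h2 <= k.-1)%N &
    g = h0 \Po 'X^3 + (h1 \Po 'X^3) * (- 'X - 'X^2) + (h2 \Po 'X^3) * (- 'X - 'X^2) ^+ 2].
Proof.
move=> z3 zz sg; have [A [B [C [sA sB sC ->]]]] := poly_mod3 sg.
rewrite !(hornerXn, hornerX, hornerD, horner_comp, hornerM).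
have z6 : (z ^+ 2) ^+ 3 = 1 by rewrite -exprM mulnC exprM z3 expr1n.
have z4 : (z ^+ 2) ^+ 2 = z by rewrite -exprM (exprD z 3 1) z3 mul1r.
rewrite z6 z4 z3 => e.
(* Both parameters have cube 1, so the condition compares [B(1) z + C(1) z^2] with
   [B(1) z^2 + C(1) z]. *)
have eBC : B.[1] = C.[1].
  have zz0 : z - z ^+ 2 != 0 by rewrite subr_eq0.
  apply: (mulfI zz0); apply/eqP; rewrite -subr_eq0; apply/eqP.
  transitivity (A.[1] + z * B.[1] + z ^+ 2 * C.[1] - (A.[1] + z ^+ 2 * B.[1] + z * C.[1])).
    by ring.
  by rewrite e subrr.
have /factor_theorem [h eh] : root (B - C) 1.
  by rewrite /root hornerD hornerN eBC subrr.
have sh : (size h <= k.-1)%N.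
  have [->|h0] := eqVneq h 0; first by rewrite size_poly0.
  have : (size (B - C)%R <= k)%N.
    by apply: (leq_trans (size_polyD _ _)); rewrite size_polyN geq_max sB sC.
  rewrite eh size_mul ?polyXsubC_eq0 // size_XsubC addn2 /= => lt_hk.
  by rewrite -ltnS prednK // (leq_trans _ lt_hk).
have sh' : (size h <= k)%N by apply: leq_trans sh (leq_pred _).
(* With [B - C = h (X - 1)], these come from [(- t - t^2)^2 = t^2 + 2 t^3 + t^4] by comparing
   exponents modulo 3. *)
exists (A - h * 'X *+ 2), (h - C), h; split => //.
- apply: (leq_trans (size_polyD _ _)); rewrite geq_max sA size_polyN /=.
  rewrite -scaler_nat (leq_trans (size_scale_leq _ _)) //.
  by rewrite (leq_trans (size_polyMleq _ _)) // size_polyX addn2.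
- by apply: (leq_trans (size_polyD _ _)); rewrite size_polyN geq_max sh' sC.
have -> : B = h * ('X - 1%:P) + C by rewrite -eh subrK.
rewrite !(comp_polyB, comp_polyD, comp_polyM, comp_polyX, comp_polyC, mulr2n) polyC1.
rewrite (raddfN (comp_poly 'X^3)) /= !(comp_polyD, comp_polyM, comp_polyX).
by ring.
Qed.

Lemma horner_nodal (K F : fieldType) (iota : {rmorphism K -> F}) (h0 h1 h2 : {poly K}) t :
  (map_poly iota (h0 \Po 'X^3 + (h1 \Po 'X^3) * (- 'X - 'X^2)
     + (h2 \Po 'X^3) * (- 'X - 'X^2) ^+ 2)).[t] =
  (map_poly iota h0).[t ^+ 3] + (map_poly iota h1).[t ^+ 3] * (- t - t ^+ 2)
     + (map_poly iota h2).[t ^+ 3] * (- t - t ^+ 2) ^+ 2.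
Proof.
have hC (h : {poly K}) : (map_poly iota (h \Po 'X^3)).[t] = (map_poly iota h).[t ^+ 3].
  by rewrite map_comp_poly map_polyXn horner_comp hornerXn.
have hY : (map_poly iota (- 'X - 'X^2)).[t] = - t - t ^+ 2.
  rewrite (rmorphD (map_poly iota)) !(rmorphN (map_poly iota)) /= map_polyX map_polyXn.
  by rewrite hornerD !hornerN hornerX hornerXn.
rewrite !(rmorphD (map_poly iota)) !(rmorphM (map_poly iota)) /=.
by rewrite !hornerD !hornerM !hC !hY.
Qed.

Lemma size_mul_bound (R : nzRingType) (p r : {poly R}) d e :
  (size p <= d.+1)%N -> (size r <= e.+1)%N -> (size (p * r)%R <= (d + e).+1)%N.
Proof.
move=> hp hr; apply: (leq_trans (size_polyMleq _ _)).
by move: hp hr; move: (size p) (size r) => n n'; clear; lia.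
Qed.

Lemma size_exp_bound (R : nzRingType) (p : {poly R}) d n :
  (size p <= d.+1)%N -> (size (p ^+ n)%R <= (d * n).+1)%N.
Proof.
move=> hp; elim: n => [|n IH]; first by rewrite expr0 muln0 size_poly1.
by rewrite exprS mulnS; apply: size_mul_bound.
Qed.

(** At a root of [1 + t + t^2], all of [t^3], [- t - t^2] and [- (1 + t)^3] equal 1; so a monomial
    takes its coefficient as value at both parameters of the node. *)
Lemma nodal_monomial (K F : fieldType) (iota : {rmorphism K -> F}) (c : K) i j l :
  exists G : {poly K}, [/\ (size G <= (3 * (i + j + l)).+1)%N,
    forall t, (map_poly iota G).[t] =
      iota c * ((t ^+ 3) ^+ i * (- t - t ^+ 2) ^+ j * (- (1 + t) ^+ 3) ^+ l) &
    forall z, z ^+ 3 = 1 -> 1 + z + z ^+ 2 = 0 -> G.[z] = c].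
Proof.
pose P3 : {poly K} := 'X^3; pose PY : {poly K} := - 'X - 'X^2.
pose PZ : {poly K} := - (1 + 'X) ^+ 3.
have s1 : (size (1 + 'X : {poly K})%R <= 2)%N.
  by rewrite (leq_trans (size_polyD _ _)) // size_poly1 size_polyX.
have s3 : (size P3 <= 4)%N by rewrite size_polyXn.
have sY : (size PY <= 3)%N.
  by rewrite (leq_trans (size_polyD _ _)) // !size_polyN size_polyX size_polyXn.
have sZ : (size PZ <= 4)%N by rewrite size_polyN (size_exp_bound (d := 1)).
have e3 t : (map_poly iota P3).[t] = t ^+ 3 by rewrite map_polyXn hornerXn.
have eY t : (map_poly iota PY).[t] = - t - t ^+ 2.
  rewrite (rmorphD (map_poly iota)) !(rmorphN (map_poly iota)) /= map_polyX map_polyXn.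
  by rewrite hornerD !hornerN hornerX hornerXn.
have eZ t : (map_poly iota PZ).[t] = - (1 + t) ^+ 3.
  rewrite (rmorphN (map_poly iota)) /= rmorphXn /= (rmorphD (map_poly iota)) rmorph1 /=.
  by rewrite map_polyX hornerN horner_exp hornerD hornerX hornerC.
have z3 z : P3.[z] = z ^+ 3 by rewrite hornerXn.
have zY z : PY.[z] = - z - z ^+ 2 by rewrite hornerD !hornerN hornerX hornerXn.
have zZ z : PZ.[z] = - (1 + z) ^+ 3 by rewrite hornerN horner_exp hornerD hornerX hornerC.
clearbody P3 PY PZ.
exists (c *: (P3 ^+ i * PY ^+ j * PZ ^+ l)); split.
- apply: (leq_trans (size_scale_leq _ _)).
  have := size_mul_bound (size_mul_bound (size_exp_bound i s3) (size_exp_bound j sY))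
    (size_exp_bound l sZ).
  by move/leq_trans; apply; clear; lia.
- move=> t; rewrite linearZ /= !(rmorphM (map_poly iota)) /= !(rmorphXn (map_poly iota)) /=.
  by rewrite hornerZ !hornerM !horner_exp e3 eY eZ.
move=> z hz hz2; rewrite hornerZ !hornerM !horner_exp z3 zY zZ hz.
have e1 : - z - z ^+ 2 = 1.
  by apply/eqP; rewrite -subr_eq0 -oppr_eq0 -hz2; apply/eqP; ring.
have e2 : 1 + z = - z ^+ 2 by apply/eqP; rewrite -subr_eq0 opprK hz2.
have e4 : - (- z ^+ 2) ^+ 3 = (z ^+ 3) ^+ 2 by ring.
by rewrite e1 e2 e4 hz !expr1n !mulr1.
Qed.

(** * Divisor of the tangent cubic and pole orders *)

Lemma frobenius_additive (R : comNzRingType) p e (u w : R) : p \in [pchar R] ->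
  (u + w) ^+ (p ^ e) = u ^+ (p ^ e) + w ^+ (p ^ e).
Proof.
by move=> hp; apply: exprDn_pchar; rewrite pnatX (eq_pnat _ (pcharf_eq hp)) pnat_id ?(pcharf_prime hp).
Qed.

(** For [n = m] and [S = s^q], [A] and [B] are [(s^3)^(m-1)] and [(- (1 + s)^3)^(m-1)], found from
    [s^(3 m) = s S], and the left side is the value of [tangent_cofactor] at [P]. *)
Lemma cofactor_value (L : fieldType) (s S A B : L) n : s != 0 -> 1 + s != 0 ->
  1 + s + s ^+ 2 != 0 -> A = s * S / s ^+ 3 -> B = - ((1 + s) * (1 + S)) / (1 + s) ^+ 3 ->
  S * (1 + (2%:R + s) * (s ^+ 3 / (1 + s + s ^+ 2) ^+ 2)) * (B *+ n) -
   (1 + S) * ((1 - s) * (s ^+ 3 / (1 + s + s ^+ 2) ^+ 2)) * (A *+ n) =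
  - (n%:R * S * (1 + S)) / (1 + s + s ^+ 2).
Proof.
move=> s0 s1 s2 eA eB; rewrite -(mulr_natr A n) -(mulr_natr B n) eA eB.
move: (n%:R) => k.
by field; rewrite s0 s1 s2.
Qed.

Lemma rescale_monomial (L : fieldType) (H A B x y : L) i j l :
  A != 0 -> B != 0 -> x != 0 ->
  H * x ^+ i * ((y ^+ 3 / x) ^+ l * y ^+ j) =
  H / A ^+ i / B ^+ j * (A / B ^+ 3) ^+ l *
    ((A * x) ^+ i * (B * y) ^+ j * ((B * y) ^+ 3 / (A * x)) ^+ l).
Proof.
move=> A0 B0 x0; rewrite -(exprVn A) -(exprVn B).
have e1 : x ^+ i = A^-1 ^+ i * (A * x) ^+ i by rewrite -exprMn mulKf.
have e2 : y ^+ j = B^-1 ^+ j * (B * y) ^+ j by rewrite -exprMn mulKf.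
have e3 : (y ^+ 3 / x) ^+ l = (A / B ^+ 3) ^+ l * ((B * y) ^+ 3 / (A * x)) ^+ l.
  by rewrite -exprMn; congr (_ ^+ _); field; rewrite A0 B0 x0.
rewrite e1 e2 e3; move: (_ ^+ i) (_ ^+ j) (_ ^+ l) => a1 a2 a3.
by move: (_ ^+ i) (_ ^+ j) (_ ^+ l) => b1 b2 b3; ring.
Qed.

Section Tangent.
Context {K : closedFieldType} {F : fieldType} {iota : {rmorphism K -> F}}.
Context {p e q m : nat} (hpK : p \in [pchar K]) (e_gt0 : (0 < e)%N) (def_q : q = (p ^ e)%N).
Context (hq : q.+1 = (3 * m)%N) (m_gt0 : (0 < m)%N).
Context {x y : F} (hF : is_function_field_X3 iota q m x y).
Context {a b : K} (a0 : a != 0) (hab : b ^+ q.+1 + a ^+ (2 * m) + a ^+ m = 0)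
  (hnotrat : ~~ ((a ^+ (q ^ 2) == a) && (b ^+ (q ^ 2) == b))).

Lemma qK : q%:R = 0 :> K.
Proof. by rewrite def_q natrX (pcharf0 hpK) expr0n eqn0Ngt e_gt0. Qed.

Lemma q_gt1 : (1 < q)%N.
Proof.
by rewrite def_q -(exp1n e) ltn_exp2r // prime_gt1 // (pcharf_prime hpK).
Qed.

Lemma frobK (u w : K) : (u + w) ^+ q = u ^+ q + w ^+ q.
Proof. by rewrite def_q; apply: frobenius_additive. Qed.

Lemma frobF (u w : F) : (u + w) ^+ q = u ^+ q + w ^+ q.
Proof. by rewrite def_q; apply: frobenius_additive; rewrite (fmorph_pchar iota). Qed.

Lemma frobN (R : pzRingType) (u : R) : (forall u w : R, (u + w) ^+ q = u ^+ q + w ^+ q) ->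
  (- u) ^+ q = - u ^+ q.
Proof.
move=> fr; apply/eqP; rewrite -addr_eq0 addrC -fr subrr expr0n.
by rewrite eqn0Ngt (ltnW q_gt1).
Qed.

Lemma frobB (u w : K) : (u - w) ^+ q = u ^+ q - w ^+ q.
Proof. by rewrite frobK frobN //; apply: frobK. Qed.

Lemma frob_inj (u w : K) : u ^+ q = w ^+ q -> u = w.
Proof.
move=> h; apply/eqP; rewrite -subr_eq0.
have := frobB u w; rewrite h subrr => /eqP; by rewrite expf_eq0 => /andP [].
Qed.

Let s := a ^+ m.
Let S := s ^+ q.

Lemma bq1 : b ^+ q.+1 = - (s + s ^+ 2).
Proof.
apply/eqP; rewrite -addr_eq0 /s -exprM [(m * 2)%N]mulnC addrCA addrC -hab.
by rewrite addrAC.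
Qed.

Lemma aq1 : a ^+ q.+1 = s ^+ 3.
Proof. by rewrite hq mulnC exprM. Qed.

Lemma aqq : a ^+ q * a ^+ (q ^ 2) = S ^+ 3.
Proof. by rewrite -exprM mulnC exprM -aq1 -!exprM mulSn exprD mulnn. Qed.

Lemma bqq : b ^+ q * b ^+ (q ^ 2) = - (S + S ^+ 2).
Proof.
have -> : - (S + S ^+ 2) = (- (s + s ^+ 2)) ^+ q.
  by rewrite frobN ?frobK ?/S -?exprM 1?[(2 * q)%N]mulnC //; apply: frobK.
by rewrite -bq1 -exprM mulSn exprD mulnn.
Qed.

(** Multiplication by [a^q] takes [a] and its conjugate to [s^3] and [S^3]; multiplication by [b^q]
    takes [b] and its conjugate to [- (s + s^2)] and [- (S + S^2)]. *)
Lemma not_rational : S ^+ 3 = s ^+ 3 -> S + S ^+ 2 = s + s ^+ 2 -> False.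
Proof.
move=> h3 h2; case/negP: hnotrat; apply/andP; split; apply/eqP.
  apply: (mulfI (expf_neq0 q a0)); by rewrite aqq h3 -aq1 exprSr.
have [->|b0] := eqVneq b 0.
  by rewrite expr0n expn_eq0 andbT eqn0Ngt (ltnW q_gt1).
by apply: (mulfI (expf_neq0 q b0)); rewrite bqq h2 -bq1 exprSr.
Qed.

Lemma s_neq0 : s != 0. Proof. exact: expf_neq0. Qed.

Lemma S_neq_s : S != s.
Proof. by apply/negP => /eqP h; apply: not_rational; rewrite h. Qed.

Lemma s1_neq0 : 1 + s != 0.
Proof.
apply/negP; rewrite addrC addr_eq0 => /eqP h.
have hS : S = s by rewrite /S h frobN ?expr1n //; apply: frobK.
by have := S_neq_s; rewrite hS eqxx.
Qed.

(** Otherwise [s] and [S] would both be parameters of the node, and [P] would equal its conjugate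
    even if [S] and [s] differ. *)
Lemma s2_neq0 : 1 + s + s ^+ 2 != 0.
Proof.
apply/negP => /eqP h.
have h1 : s + s ^+ 2 = -1 by apply/eqP; rewrite -addr_eq0 addrC addrA h.
have hS : S + S ^+ 2 = -1.
  have -> : S + S ^+ 2 = (s + s ^+ 2) ^+ q by rewrite frobK /S -!exprM [(2 * q)%N]mulnC.
  by rewrite h1 frobN ?expr1n //; apply: frobK.
have cube (u : K) : u + u ^+ 2 = -1 -> u ^+ 3 = 1.
  move=> hu; have : (u - 1) * (1 + (u + u ^+ 2)) = 0 by rewrite hu subrr mulr0.
  by move=> hu2; apply/eqP; rewrite -subr_eq0 -hu2; apply/eqP; ring.
by apply: not_rational; rewrite ?cube // hS h1.
Qed.

Lemma b_neq0 : b != 0.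
Proof.
apply/negP => /eqP b0; have := bq1; rewrite b0 expr0n /= => /eqP.
rewrite eq_sym oppr_eq0 -[X in X + _]mulr1 expr2 -mulrDr mulf_eq0.
by rewrite (negbTE s_neq0) (negbTE s1_neq0).
Qed.

Lemma S_neq0 : S != 0. Proof. exact/expf_neq0/s_neq0. Qed.

Lemma S1_neq0 : 1 + S != 0.
Proof. by have := expf_neq0 q s1_neq0; rewrite frobK expr1n. Qed.

Lemma S2_neq0 : 1 + S + S ^+ 2 != 0.
Proof.
have := expf_neq0 q s2_neq0.
by rewrite !frobK expr1n /S -!exprM [(2 * q)%N]mulnC.
Qed.

(* [lam] below is the product of the three conjugates of the tangent line at a point of
   the Hermitian curve above [(a, b)], in coordinates where that line is [u + w + 1 = 0];
   [tau] is the coordinate [u] along it. *)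
Let X : F := iota (a ^+ q) * x.
Let Y : F := iota (b ^+ q) * y.
Let Z : F := Y ^+ 3 / X.

Lemma X_neq0 : X != 0.
Proof. by rewrite mulf_neq0 ?fmorph_eq0 ?expf_neq0 // (x_neq0 hF). Qed.

Lemma XZ_Y : X * Z = Y ^+ 3.
Proof. by rewrite mulrC divfK // X_neq0. Qed.

Lemma Y1_neq0 : 1 - Y != 0.
Proof.
have ibq0 : iota (b ^+ q) != 0 by rewrite fmorph_eq0 expf_neq0 // b_neq0.
apply/negP => /eqP h; have /negP [] := y_neq hq m_gt0 hF (b ^+ q)^-1; apply/eqP.
apply: (mulfI ibq0); rewrite mulrBr mulr0 -[_ * y]/Y -rmorphM mulfV ?rmorph1.
  by rewrite -opprB h oppr0.
by rewrite expf_neq0 // b_neq0.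
Qed.

(** In the rescaled coordinates [X^m = S x^m], and [z^m = - (x^m + 1)] becomes
    [Z^m = (1 + S) (x^m + 1)]. *)
Lemma curve_XZ : X ^+ m * (1 + iota S) - Z ^+ m * iota S + iota S * (1 + iota S) = 0.
Proof.
apply: (mulfI (expf_neq0 m X_neq0)); rewrite mulr0.
have eXZ : X ^+ m * Z ^+ m = Y ^+ q.+1 by rewrite -exprMn XZ_Y -exprM -hq.
have eX : X ^+ m = iota S * x ^+ m.
  by rewrite exprMn -rmorphXn -exprM [(q * m)%N]mulnC exprM.
have eY : Y ^+ q.+1 = (iota S + iota S ^+ 2) * (x ^+ (2 * m) + x ^+ m).
  have -> : Y ^+ q.+1 = iota ((b ^+ q.+1) ^+ q) * y ^+ q.+1.
    by rewrite exprMn -rmorphXn -!exprM [(q.+1 * q)%N]mulnC.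
  rewrite (curve_eq hF) bq1 frobN; last exact: frobK.
  rewrite frobK -[(s ^+ 2) ^+ q]exprM [(2 * q)%N]mulnC exprM rmorphN rmorphD rmorphXn.
  by rewrite mulrNN [iota (_ ^+ 2)]rmorphXn rmorphXn.
rewrite mulrDr mulrBr mulrA [X ^+ m * (Z ^+ m * _)]mulrA eXZ eY eX [(2 * m)%N]mulnC exprM; ring.
Qed.

Local Notation lam := (cubic_lam X Y Z).
Local Notation tau := (cubic_tau X Y).
Local Notation eps := (cubic_eps X Y).
Local Notation cof := (tangent_cofactor X Y Z (m := m) (iota S)).

Lemma tau_frob : tau ^+ q - iota S = (tau - iota s) ^+ q.
Proof. by rewrite frobF frobN /S ?rmorphXn //; apply: frobF. Qed.

(** The zeros of [lam] are read off from this identity: [(tau - s)^q] accounts for the order [q] at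
    [P], where the cofactor is a unit, and [tau - S] for the zero at [P']. *)
Lemma lam_cof : (tau - iota S) * (tau - iota s) ^+ q = lam * cof.
Proof.
by rewrite -tau_frob (curve_tau XZ_Y Y1_neq0 hq frobF (ltnW q_gt1) curve_XZ).
Qed.

Lemma X_nonconst c : X - iota c != 0.
Proof.
have -> : X - iota c = iota (a ^+ q) * (x - iota (c / a ^+ q)).
  by rewrite mulrBr -rmorphM [a ^+ q * _]mulrC divfK // expf_neq0.
by rewrite mulf_neq0 ?fmorph_eq0 ?expf_neq0 // (x_neq hF).
Qed.

Lemma tau_nonconst_cube t : lam = 0 -> tau - iota t != 0.
Proof.
move=> l0; apply/negP => /eqP ht; have /negP [] := X_nonconst (t ^+ 3); apply/eqP.
rewrite (cubic_X XZ_Y Y1_neq0) l0 mul0r addr0 rmorphXn subrXX ht mul0r.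
by [].
Qed.

Lemma lam_neq0 : lam != 0.
Proof.
apply/negP => /eqP l0; have := lam_cof; rewrite l0 mul0r => /eqP.
by apply/negP; rewrite mulf_neq0 ?expf_neq0 ?tau_nonconst_cube.
Qed.

Section Center.
Context {w : F -> int} (hw : is_place_valuation iota w) {t : K}
  (t0 : t != 0) (t2 : 1 + t + t ^+ 2 != 0)
  (rX : res iota w X (t ^+ 3)) (rY : res iota w Y (- t - t ^+ 2)).

Lemma res_Z : res iota w Z (- (1 + t) ^+ 3).
Proof.
have -> : - (1 + t) ^+ 3 = (- t - t ^+ 2) ^+ 3 / t ^+ 3 by field.
by apply: (res_div hw) => //; [apply: (resX hw) | rewrite expf_neq0].
Qed.

Let r1Y : res iota w (1 - Y) (1 + t + t ^+ 2).
Proof.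
have -> : 1 + t + t ^+ 2 = 1 - (- t - t ^+ 2) by ring.
exact: (resB hw res1 rY).
Qed.

Lemma res_tau : res iota w tau t.
Proof.
rewrite -[t in res _ _ _ t](_ : (t ^+ 3 - (- t - t ^+ 2)) / (1 + t + t ^+ 2) = t).
  by apply: (res_div hw) => //; apply: (resB hw).
by field.
Qed.

Lemma res_eps : res iota w eps (t ^+ 3 / (1 + t + t ^+ 2) ^+ 2).
Proof. by apply: (res_div hw) => //; [apply: (resX hw) | rewrite expf_neq0]. Qed.

Lemma res_lam : res iota w lam 0.
Proof.
have -> : 0 = t ^+ 3 + - (1 + t) ^+ 3 + 1 - 3%:R * (- t - t ^+ 2) by ring.
apply: (resB hw); last by apply: (resM hw) => //; apply: res_nat.
apply: (resD hw); last exact: res1.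
by apply: (resD hw) => //; apply: res_Z.
Qed.

Lemma res_cof : res iota w cof
  (S * (1 + (2%:R + t) * (t ^+ 3 / (1 + t + t ^+ 2) ^+ 2)) * ((- (1 + t) ^+ 3) ^+ m.-1 *+ m) -
   (1 + S) * ((1 - t) * (t ^+ 3 / (1 + t + t ^+ 2) ^+ 2)) * ((t ^+ 3) ^+ m.-1 *+ m)).
Proof.
have r1 := @res1 _ _ iota w; have rS := @res_iota _ _ iota w S; have rt := res_tau; have re := res_eps.
have sumE (f g : F) (u : K) : res iota w f u -> res iota w g u ->
    res iota w (\sum_(i < m) f ^+ (m.-1 - i) * g ^+ i) (u ^+ m.-1 *+ m).
  move=> hf hg; have -> : u ^+ m.-1 *+ m = \sum_(i < m) u ^+ (m.-1 - i) * u ^+ i.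
    rewrite -[X in _ *+ X]card_ord -sumr_const; apply: eq_bigr => i _.
    by rewrite -exprD subnK // -ltnS prednK.
  by apply: (res_sum hw) => i _; apply: (resM hw); apply: (resX hw).
apply: (resB hw); apply: (resM hw).
- apply: (resM hw) => //; apply: (resD hw) => //; apply: (resM hw) => //.
  by apply: (resD hw) => //; apply: res_nat.
- apply: sumE; first exact: res_Z.
  by apply/(resN hw)/(resX hw)/(resD hw).
- apply: (resM hw); first exact: (resD hw).
  by apply: (resM hw) => //; apply: (resB hw).
- by apply: sumE => //; apply: (resX hw).
Qed.

Lemma vge_eps : vge w 0 eps. Proof. exact: res_vge0 res_eps. Qed.

Lemma vge_tau : vge w 0 tau. Proof. exact: res_vge0 res_tau. Qed.

Lemma vge_lam n : vge w n lam -> [/\ vge w n (X - tau ^+ 3),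
  vge w n (Y - (- tau - tau ^+ 2)) & vge w n (Z - - (1 + tau) ^+ 3)].
Proof.
move=> hl; have [[ve vt] v1] := (vge_eps, vge_tau, vge1 hw).
have vmul f g : vge w 0 f -> vge w 0 g -> vge w 0 (f * g) by move=> *; apply: (vge0M hw).
split.
- have -> : X - tau ^+ 3 = lam * ((1 - tau) * eps).
    by rewrite {1}(cubic_X XZ_Y Y1_neq0); ring.
  by apply: (vgeM0 hw) => //; apply: (vmul) => //; apply: (vgeB hw).
- have -> : Y - (- tau - tau ^+ 2) = lam * eps.
    by rewrite {1}(cubic_Y XZ_Y Y1_neq0); ring.
  exact: (vgeM0 hw).
- have -> : Z - - (1 + tau) ^+ 3 = lam * (1 + (2%:R + tau) * eps).
    by rewrite {1}(cubic_Z XZ_Y Y1_neq0); ring.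
  apply: (vgeM0 hw) => //; apply: (vgeD hw) => //; apply: (vmul) => //.
  by apply: (vgeD hw) => //; apply: (vge_nat hw).
Qed.

End Center.

Lemma res_X w c : is_place_valuation iota w -> res iota w x c -> res iota w X (a ^+ q * c).
Proof. by move=> hw wx; apply: (resM hw) => //; apply: res_iota. Qed.

Lemma res_Y w c : is_place_valuation iota w -> res iota w y c -> res iota w Y (b ^+ q * c).
Proof. by move=> hw wy; apply: (resM hw) => //; apply: res_iota. Qed.

Lemma v_X_sub w c : is_place_valuation iota w ->
  w (X - iota (a ^+ q * c)) = w (x - iota c).
Proof.
move=> hw; rewrite rmorphM -mulrBr (vM hw) ?(x_neq hF) ?fmorph_eq0 ?expf_neq0 //.
by rewrite (v_iota hw) ?add0r // expf_neq0.
Qed.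

Lemma aqa : a ^+ q * a = s ^+ 3. Proof. by rewrite -exprSr aq1. Qed.

Lemma bqb : b ^+ q * b = - s - s ^+ 2. Proof. by rewrite -exprSr bq1 opprD. Qed.

Lemma mK_neq0 : m%:R != 0 :> K. Proof. exact: (mK hq qK). Qed.

Lemma conj_on_curve : (b ^+ (q ^ 2)) ^+ q.+1 + (a ^+ (q ^ 2)) ^+ (2 * m) + (a ^+ (q ^ 2)) ^+ m = 0.
Proof.
have frob2 (u w : K) : (u + w) ^+ (q ^ 2) = u ^+ (q ^ 2) + w ^+ (q ^ 2).
  by rewrite def_q -expnM; apply: frobenius_additive.
rewrite !(exprAC _ (q ^ 2)) -!frob2 hab expr0n expn_eq0 andbT.
by rewrite eqn0Ngt (ltnW q_gt1).
Qed.

Lemma cof_residue_neq0 :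
  S * (1 + (2%:R + s) * (s ^+ 3 / (1 + s + s ^+ 2) ^+ 2)) * ((- (1 + s) ^+ 3) ^+ m.-1 *+ m) -
   (1 + S) * ((1 - s) * (s ^+ 3 / (1 + s + s ^+ 2) ^+ 2)) * ((s ^+ 3) ^+ m.-1 *+ m) != 0.
Proof.
have [s0 s1 s2 S0 S1] := And5 s_neq0 s1_neq0 s2_neq0 S_neq0 S1_neq0.
have eA : (s ^+ 3) ^+ m.-1 = s * S / s ^+ 3.
  apply: (canRL (mulfK (expf_neq0 3 s0))).
  by rewrite -exprSr prednK // -exprM -hq exprS.
have eB : (- (1 + s) ^+ 3) ^+ m.-1 = - ((1 + s) * (1 + S)) / (1 + s) ^+ 3.
  have c0 : - (1 + s) ^+ 3 != 0 by rewrite oppr_eq0 expf_neq0.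
  rewrite mulNr -mulrN -invrN; apply: (canRL (mulfK c0)).
  rewrite -exprSr prednK // exprNn (frob_signN1 hq frobK (ltnW q_gt1)) mul1r.
  by rewrite -exprM -hq exprS frobK expr1n.
rewrite (cofactor_value m s0 s1 s2 eA eB).
by rewrite mulf_neq0 ?invr_eq0 // oppr_eq0 !mulf_neq0 // mK_neq0.
Qed.

Lemma tangent_order w : is_place_valuation iota w -> res iota w x a -> res iota w y b ->
  [/\ w lam = q, tau - iota s != 0 & w (tau - iota s) = 1].
Proof.
move=> hw wx wy; have [s0 s2] := (s_neq0, s2_neq0).
have rX : res iota w X (s ^+ 3) by rewrite -aqa; apply: res_X.
have rY : res iota w Y (- s - s ^+ 2) by rewrite -bqb; apply: res_Y.
have rt := res_tau hw s2 rX rY.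
have l0 := lam_neq0.
have [cof0 vcof] := res_unit hw (res_cof hw s0 s2 rX rY) cof_residue_neq0.
have [tS vtS] : tau - iota S != 0 /\ w (tau - iota S) = 0.
  apply: (res_unit hw (resB hw rt (res_iota S))).
  by rewrite subr_eq0 eq_sym S_neq_s.
have ts : tau - iota s != 0.
  apply: contraTneq isT => h; have := lam_cof; rewrite h expr0n eqn0Ngt (ltnW q_gt1) mulr0.
  by move/esym/eqP; rewrite mulf_eq0 (negbTE l0) (negbTE cof0).
have vl : w lam = w (tau - iota s) *+ q.
  have := congr1 w lam_cof; rewrite (vM hw) ?expf_neq0 // (vM hw) // vtS vcof.
  by rewrite (vX hw) // add0r addr0 => <-.
have vts : 1 <= w (tau - iota s) by move: rt; rewrite /res vgeE.
(* If [tau - s] had order at least 2, so would [X - s^3], since [X] and [tau^3] agree up to a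
   multiple of [lam]. But [x - a] is a local parameter at [P]. *)
suff v1 : w (tau - iota s) = 1 by rewrite vl v1; split=> //; rewrite natz.
apply/eqP; rewrite eq_le vts andbT leNgt; apply/negP => lt1.
have [w1 _] := unramified_center hq m_gt0 qK hF b_neq0 hab hw wx wy.
have : vge w 2 (X - iota (a ^+ q * a)).
  have -> : X - iota (a ^+ q * a) = (X - tau ^+ 3) + (tau ^+ 3 - iota s ^+ 3).
    by rewrite aqa rmorphXn addrA subrK.
  apply: (vgeD hw).
    have [] // := @vge_lam w hw s s2 rX rY 2.
    rewrite vgeE // vl; have := q_gt1; move: lt1; move: (w _) => n.
    by rewrite -mulr_natr natz; clear; nia.
  rewrite subrXX; apply: (vgeM0 hw); first by rewrite vgeE //; lia.
  apply: (vge_sum hw) => i _; apply: (vge0M hw); apply: (vge0X hw).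
    exact: res_vge0 rt.
  exact: vge_iota.
by rewrite vgeE ?X_nonconst // v_X_sub // w1.
Qed.

(** If [lam] had order at least 2, then by [lam_cof] so would [tau - S], and hence [X - S^3], which
    has order 1 at [P']. *)
Lemma tangent_conjugate w : is_place_valuation iota w ->
  res iota w x (a ^+ (q ^ 2)) -> res iota w y (b ^+ (q ^ 2)) ->
  w lam = 1 /\ res iota w tau S.
Proof.
move=> hw wx wy; have [S0 S2] := (S_neq0, S2_neq0).
have rX : res iota w X (S ^+ 3) by rewrite -aqq; apply: res_X.
have rY : res iota w Y (- S - S ^+ 2) by rewrite -opprD -bqq; apply: res_Y.
have rt := res_tau hw S2 rX rY; split=> //.
have l0 := lam_neq0.
have rl : 1 <= w lam by have := res_lam hw S0 rX rY; rewrite res0 vgeE.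
apply/eqP; rewrite eq_le rl andbT leNgt; apply/negP => lt1.
have [ts vts] : tau - iota s != 0 /\ w (tau - iota s) = 0.
  apply: (res_unit hw (resB hw rt (res_iota s))).
  by rewrite subr_eq0 S_neq_s.
have l2 : vge w 2 lam by rewrite vgeE //; lia.
have tS2 : vge w 2 (tau - iota S).
  have : vge w 2 ((tau - iota s) ^+ q * (tau - iota S)).
    rewrite mulrC lam_cof; apply: (vgeM0 hw) => //.
    exact: res_vge0 (res_cof hw S0 S2 rX rY).
  by rewrite (vgeMr hw) ?expf_neq0 // (vX hw) // vts mul0rn subr0.
have [|w1 _] := unramified_center hq m_gt0 qK hF _ conj_on_curve hw wx wy.
  by rewrite expf_neq0 // b_neq0.
have : vge w 2 (X - iota (a ^+ q * a ^+ (q ^ 2))).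
  have -> : X - iota (a ^+ q * a ^+ (q ^ 2)) = (X - tau ^+ 3) + (tau ^+ 3 - iota S ^+ 3).
    by rewrite aqq rmorphXn addrA subrK.
  apply: (vgeD hw); first by have [] // := @vge_lam w hw S S2 rX rY 2.
  rewrite subrXX; apply: (vgeM0 hw) => //.
  apply: (vge_sum hw) => i _; apply: (vge0M hw); apply: (vge0X hw).
    exact: res_vge0 rt.
  exact: vge_iota.
by rewrite vgeE ?X_nonconst // v_X_sub // w1.
Qed.

(** At a finite zero of [lam] the residues of [X], [Y], [Z] lie on the cubic, so [curve_tau] leaves
    only the parameters [S] and [s]. *)
Lemma tangent_zeros w : is_place_valuation iota w -> vge w 0 x -> vge w 1 lam ->
  (res iota w x a /\ res iota w y b) \/
  (res iota w x (a ^+ (q ^ 2)) /\ res iota w y (b ^+ (q ^ 2))).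
Proof.
move=> hw wx wl; have [c [d [hcd rx ry]]] := place_center hF hw wx.
have [rX rY] := (res_X hw rx, res_Y hw ry).
set X0 := a ^+ q * c in rX *; set Y0 := b ^+ q * d in rY *.
pose Z0 := 0 - 1 - X0 + 3%:R * Y0.
have rZ : res iota w Z Z0.
  have -> : Z = lam - 1 - X + 3%:R * Y by rewrite /cubic_lam; ring.
  apply: (resD hw); last exact: (resM hw (res_nat 3) rY).
  apply: (resB hw) => //; apply: (resB hw); last exact: res1.
  by rewrite res0.
have XZ0 : X0 * Z0 = Y0 ^+ 3.
  by apply: (res_uniq hw (resM hw rX rZ)); rewrite XZ_Y; apply: (resX hw).
have C0 : X0 ^+ m * (1 + S) - Z0 ^+ m * S + S * (1 + S) = 0.
  have rS := @res_iota _ _ iota w S; have r1 := @res1 _ _ iota w.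
  have rc : res iota w (X ^+ m * (1 + iota S) - Z ^+ m * iota S + iota S * (1 + iota S))
     (X0 ^+ m * (1 + S) - Z0 ^+ m * S + S * (1 + S)).
    apply: (resD hw); last by apply: (resM hw) => //; apply: (resD hw).
    apply: (resB hw); apply: (resM hw); rewrite ?rS //; try exact: (resX hw).
    exact: (resD hw).
  apply: (res_uniq hw rc); rewrite curve_XZ -(rmorph0 iota); exact: res_iota.
have l0 : cubic_lam X0 Y0 Z0 = 0 by rewrite /cubic_lam /Z0; ring.
(* [Y0 = 1] is the node, where [curve_tau] does not apply: there [X0 = Z0 = 1], and [C0] reads
   [1 + S + S^2 = 0]. *)
have [Y1|Y1] := eqVneq (1 - Y0) 0.
  have eY : Y0 = 1 by apply/eqP; rewrite eq_sym -subr_eq0 Y1.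
  have eX : X0 = 1.
    apply/eqP; rewrite -subr_eq0 -sqrf_eq0; apply/eqP.
    transitivity (Y0 ^+ 3 - X0 * Z0); last by rewrite XZ0 subrr.
    by rewrite /Z0 eY; ring.
  have eZ : Z0 = 1 by rewrite /Z0 eX eY; ring.
  have := S2_neq0; rewrite -[X in X != 0](_ : 0 = 1 + S + S ^+ 2) ?eqxx //.
  by rewrite -C0 eX eZ !expr1n; ring.
have := curve_tau XZ0 Y1 hq frobK (ltnW q_gt1) C0; rewrite l0 mul0r => /eqP.
have eX := cubic_X XZ0 Y1; have eY := cubic_Y XZ0 Y1.
rewrite l0 !mul0r !addr0 in eX eY.
rewrite mulf_eq0 !subr_eq0 => /orP [/eqP et|/eqP /frob_inj et].
  right; rewrite et in eX eY.
  have -> : a ^+ (q ^ 2) = c by apply: (mulfI (expf_neq0 q a0)); rewrite aqq -eX.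
  suff -> : b ^+ (q ^ 2) = d by [].
  by apply: (mulfI (expf_neq0 q b_neq0)); rewrite bqq opprD -eY.
left; rewrite et in eX eY.
have -> : a = c by apply: (mulfI (expf_neq0 q a0)); rewrite aqa -eX.
suff -> : b = d by [].
by apply: (mulfI (expf_neq0 q b_neq0)); rewrite bqb -eY.
Qed.

Lemma tangent_inf w : is_place_valuation iota w -> w x < 0 ->
  w lam = w x /\ vge w (w x) y.
Proof.
move=> hw wx; have x0 := x_neq0 hF; have hinf := chart_inf hq m_gt0 hF.
have vx1 : vge w 1 x^-1 by rewrite vgeE ?invr_eq0 // (vV hw) //; lia.
have rx1 : res iota w x^-1 0 by rewrite res0.
have wy1 := place_regular_y hinf hw (res_vge0 hw rx1).
set y1 := y / x in hinf wy1; set z1 := y1 ^+ 3 / x^-1.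
have ez1 : z1 ^+ m = - (x^-1 ^+ m + 1) := zX_eq hq hinf.
have rz1m : res iota w (z1 ^+ m) (-1).
  rewrite ez1; apply: (resN hw).
  rewrite -[X in res _ _ _ X]add0r; apply: (resD hw); last exact: res1.
  have -> : (0 : K) = 0 ^+ m by rewrite expr0n eqn0Ngt m_gt0.
  exact: (resX hw).
have wz1 : vge w 0 z1 by apply: (vgeX_inv hw m_gt0); apply: res_vge0 rz1m.
have [||g rg rz1] := @residue_root _ _ _ _ hw ('X^m - (-1)%:P) z1 _ wz1.
- by rewrite -size_poly_eq0 size_XnsubC.
- rewrite rmorphB /= map_polyXn map_polyC hornerD hornerN hornerXn hornerC.
  exact: rz1m.
have gm : g ^+ m = -1.
  by move: rg; rewrite /root hornerD hornerN hornerXn hornerC subr_eq0 => /eqP.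
have y10 : y1 != 0 by rewrite mulf_neq0 ?invr_eq0 // (y_neq0 m_gt0 hF).
have vy1 : vge w 1 y1.
  have : vge w 1 (y1 ^+ 3).
    have -> : y1 ^+ 3 = x^-1 * z1 by rewrite mulrC divfK // invr_eq0.
    exact: (vgeM0 hw).
  by rewrite !vgeE ?expf_neq0 // (vX hw) // -mulr_natr natz; move: (w y1) => n; clear; lia.
split; last first.
  have -> : y = x * y1 by rewrite mulrC divfK.
  by apply: (vgeM0 hw) => //; rewrite vgeE.
pose u := iota (a ^+ q) + iota (b ^+ q) ^+ 3 / iota (a ^+ q) * z1 + x^-1
   - 3%:R * (iota (b ^+ q) * y1).
have ia0 : iota (a ^+ q) != 0 by rewrite fmorph_eq0 expf_neq0.
have el : lam = x * u.
  rewrite /cubic_lam /u /Z /X /Y /z1 /y1 invrK; move: ia0 x0.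
  by move: (iota _) (iota _) => A B A0 x0; field; rewrite x0 A0.
have ru : res iota w u (a ^+ q + (b ^+ q) ^+ 3 / a ^+ q * g).
  rewrite -[X in res _ _ _ X]addr0 -[X in res _ _ _ X]subr0 /u.
  apply: (resB hw); last first.
    rewrite res0; apply: (vge0M hw); first exact: (vge_nat hw).
    by apply: (vge0M hw) => //; apply: vge_iota.
  apply: (resD hw) => //; apply: (resD hw); first exact: res_iota.
  apply: (resM hw) => //; rewrite -rmorphXn -fmorphV -rmorphM; exact: res_iota.
have [|u0 wu] := res_unit hw ru; last by rewrite el (vM hw) // wu addr0.
have aq0 : a ^+ q != 0 by rewrite expf_neq0.
(* If this residue vanished, taking [m]-th powers and using [g^m = -1] would give
   [S + S^2 = S^2]. *)
apply/negP => /eqP h.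
have e1 : (b ^+ q) ^+ 3 * g = - (a ^+ q) ^+ 2.
  apply/eqP; rewrite -addr_eq0; apply/eqP.
  rewrite -[RHS](mulr0 (a ^+ q)) -h; by field.
have := congr1 (fun f => f ^+ m) e1; rewrite /= exprMn gm.
have -> : (b ^+ q) ^+ 3 ^+ m = (b ^+ q.+1) ^+ q by rewrite -!exprM -hq mulnC.
have -> : (- (a ^+ q) ^+ 2) ^+ m = S ^+ 2.
  rewrite exprNn (frob_signN1 hq frobK (ltnW q_gt1)) mul1r /S /s -!exprM.
  by congr (_ ^+ _); clear; lia.
rewrite bq1 frobN; last exact: frobK.
rewrite frobK mulrN1 opprK -[s ^+ q]/S -exprM [(2 * q)%N]mulnC exprM -/S => /eqP.
by rewrite -subr_eq0 addrK (negbTE S_neq0).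
Qed.

Lemma finite_regular w : is_place_valuation iota w -> vge w 0 x ->
  [/\ vge w 0 X, vge w 0 Y & vge w 0 lam].
Proof.
move=> hw wx; have wy := place_regular_y hF hw wx.
have wX : vge w 0 X by apply: (vge0M hw) => //; apply: vge_iota.
have wY : vge w 0 Y by apply: (vge0M hw) => //; apply: vge_iota.
have w1 := vge1 hw.
have wS : vge w 0 (iota S) by apply: vge_iota.
have wZ : vge w 0 Z.
  apply: (vgeX_inv hw m_gt0).
  have -> : Z ^+ m = (iota S)^-1 * (X ^+ m * (1 + iota S) + iota S * (1 + iota S)).
    have S0 : iota S != 0 by rewrite fmorph_eq0 S_neq0.
    apply: (mulfI S0); rewrite mulrA mulfV // mul1r; apply/eqP.
    by rewrite -subr_eq0 -oppr_eq0 -curve_XZ; apply/eqP; ring.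
  apply: (vge0M hw); first by rewrite -fmorphV; apply: vge_iota.
  apply: (vgeD hw); apply: (vge0M hw) => //; try exact: (vgeD hw).
  exact: (vge0X hw).
split=> //; apply: (vgeB hw); last by apply: (vge0M hw) => //; apply: (vge_nat hw).
by do ![apply: (vgeD hw) => //].
Qed.

(** * Pole numbers at [P] and the condition at the node *)

Section CubeRoot.
Context {zeta : K} (hz : 3.-primitive_root zeta)
  (hPj : forall j : nat, (2 <= j)%N -> (j <= m - 1)%N -> Pval zeta j (alpha m a) != 0).

Lemma zeta3 : zeta ^+ 3 = 1. Proof. exact: prim_expr_order hz. Qed.

Lemma zeta_neq : zeta != zeta ^+ 2.
Proof. by rewrite -{1}[zeta]expr1 (eq_prim_root_expr hz). Qed.

Lemma zeta_sum : 1 + zeta + zeta ^+ 2 = 0.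
Proof.
have z1 : zeta - 1 != 0.
  by rewrite subr_eq0 -[X in _ == X](expr0 zeta) -{1}[zeta]expr1 (eq_prim_root_expr hz).
apply: (mulfI z1); rewrite mulr0; transitivity (zeta ^+ 3 - 1); first by ring.
by rewrite zeta3 subrr.
Qed.

Lemma zeta_q : zeta ^+ q = zeta ^+ 2.
Proof.
apply/eqP; rewrite (eq_prim_root_expr hz) eqn_mod_dvd; last exact: q_gt1.
have -> : (q - 2 = 3 * m.-1)%N by move: hq m_gt0; clear; lia.
exact: dvdn_mulr.
Qed.

Lemma three_neq0 : 3%:R != 0 :> K.
Proof.
have : (3 * m)%:R != 0 :> K by rewrite -hq -natr1 qK add0r oner_neq0.
by rewrite natrM mulf_eq0 negb_or => /andP [].
Qed.

Lemma zeta_sub_neq0 u : 1 + u + u ^+ 2 != 0 -> zeta - u != 0 /\ zeta ^+ 2 - u != 0.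
Proof.
have -> : 1 + u + u ^+ 2 = (zeta - u) * (zeta ^+ 2 - u).
  transitivity (zeta ^+ 3 - (zeta + zeta ^+ 2) * u + u ^+ 2); last by ring.
  have -> : zeta + zeta ^+ 2 = -1 by apply/eqP; rewrite -addr_eq0 addrC addrA zeta_sum.
  by rewrite zeta3; ring.
by rewrite mulf_eq0 negb_or => /andP.
Qed.

(* [(zeta - s)^q (zeta - S)] is the equation of the curve at the node of the tangent cubic. *)
Lemma node_curve :
  (zeta - s) ^+ q * (zeta - S) = (zeta ^+ 2 - s) ^+ q * (zeta ^+ 2 - S).
Proof.
by rewrite !frobB -exprM mulnC exprM zeta_q -exprM (exprD zeta 3 1) zeta3 mul1r mulrC.
Qed.

(** For [d >= 2] this is the hypothesis on [Pval]: [1 + s] times [alpha + zeta] is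
    [zeta^2 (zeta^2 - s)], and [1 + s] times [alpha + zeta^2] is [zeta (zeta - s)]. For [d = 1] the
    difference is computed to be [3 (zeta - zeta^2) s (1 + s)]. *)
Lemma cube_neq d : (0 < d)%N -> (d < m)%N ->
  (zeta - s) ^+ (3 * d) != (zeta ^+ 2 - s) ^+ (3 * d).
Proof.
have z6 : zeta ^+ 6 = 1 by rewrite (exprM zeta 3 2) zeta3 expr1n.
have z4 : zeta ^+ 4 = zeta by rewrite (exprD zeta 3 1) zeta3 mul1r.
case: d => [//|[_ _|d _ lt_dm]].
  rewrite muln1 -subr_eq0.
  have -> : (zeta - s) ^+ 3 - (zeta ^+ 2 - s) ^+ 3 = 3%:R * (zeta - zeta ^+ 2) * (s * (1 + s)).
    transitivity (zeta ^+ 3 - zeta ^+ 6 + 3%:R * s * (zeta ^+ 4 - zeta ^+ 2) +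
       3%:R * s ^+ 2 * (zeta - zeta ^+ 2)); first by ring.
    by rewrite zeta3 z6 z4; ring.
  by rewrite !mulf_neq0 ?three_neq0 ?subr_eq0 ?zeta_neq ?s_neq0 ?s1_neq0.
have := hPj (j := d.+2) isT; rewrite subn1 -ltnS prednK // => /(_ lt_dm).
apply: contraNneq => h; rewrite /Pval /alpha -/s.
have s1 := s1_neq0.
have e1 : s / (1 + s) + zeta = zeta ^+ 2 * (zeta ^+ 2 - s) / (1 + s).
  apply: (mulIf s1); rewrite divfK // mulrDl divfK // mulrBr -exprD z4.
  rewrite -[RHS]addr0 -[X in _ = _ + X](mul0r s) -zeta_sum; ring.
have e2 : s / (1 + s) + zeta ^+ 2 = zeta * (zeta - s) / (1 + s).
  apply: (mulIf s1); rewrite divfK // mulrDl divfK //.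
  rewrite -[RHS]addr0 -[X in _ = _ + X](mul0r s) -zeta_sum; ring.
have zD : zeta ^+ (3 * d.+2) = 1 by rewrite exprM zeta3 expr1n.
by rewrite e1 e2 !exprMn h !zD !mul1r subrr mul0r.
Qed.

Lemma node_neq d j : (0 < d)%N -> (d < m)%N -> (j + 3 * d = q)%N ->
  (zeta - s) ^+ j * (zeta - S) != (zeta ^+ 2 - s) ^+ j * (zeta ^+ 2 - S).
Proof.
move=> d0 dm jd; apply: contraNneq (cube_neq d0 dm) => h.
have [u0 u0'] := zeta_sub_neq0 s2_neq0; have [U0 U0'] := zeta_sub_neq0 S2_neq0.
have h0 : (zeta - s) ^+ j * (zeta - S) != 0 by rewrite mulf_neq0 ?expf_neq0.
apply/eqP; apply: (mulfI h0); rewrite {2}h.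
have := node_curve; rewrite -jd !exprD => node.
by rewrite mulrAC node mulrAC.
Qed.

Lemma numerator k i : (0 < k)%N -> (i + 3 <= 3 * k \/ i + 2 <= 3 * k /\ k < m)%N ->
  exists g g2 : {poly K}, [/\ (size g <= (3 * k).+1)%N, g.[zeta] = g.[zeta ^+ 2],
    g.[S] = 0, g = ('X - s%:P) ^+ i * g2 & g2.[s] != 0].
Proof.
move=> k0 hk.
pose A := (zeta - s) ^+ i * (zeta - S).
pose B := (zeta ^+ 2 - s) ^+ i * (zeta ^+ 2 - S).
(* [l(zeta)] and [l(zeta^2)] are in the ratio of [B] to [A], which equalises the values of
   [(t - s)^i (t - S) l(t)] at the node. *)
pose l : {poly K} := B *: ('X - (zeta ^+ 2)%:P) - A *: ('X - zeta%:P).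
have lE u : l.[u] = B * (u - zeta ^+ 2) - A * (u - zeta).
  by rewrite /l hornerD hornerN !hornerZ !hornerXsubC.
have sl : (size l <= 2)%N.
  apply: (leq_trans (size_polyD _ _)); rewrite size_polyN geq_max.
  by rewrite !(leq_trans (size_scale_leq _ _)) ?size_XsubC.
clearbody l.
have [g1 [sg1 g1z g1s]] : exists g1 : {poly K}, [/\ (i + size g1 <= 3 * k)%N,
    A * g1.[zeta] = B * g1.[zeta ^+ 2] & g1.[s] != 0].
  have lz : A * l.[zeta] = B * l.[zeta ^+ 2] by rewrite !lE; ring.
  (* If [l(s) = 0] and degree 2 is allowed, a quadratic vanishing at both cube roots is added. If it
     is not, [i + 2 = 3 k], and [l(s) = 0] says that [(t - s)^(i+1) (t - S)] takes equal values at
     the node, against [node_neq] with [d = m - k]. *)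
  have [ls|ls] := eqVneq l.[s] 0; last first.
    by exists l; split=> //; move: sl hk; move: (size l) => n; clear; lia.
  have ik : (i + 3 <= 3 * k)%N.
    case: hk => // -[hik km]; rewrite leqNgt; apply/negP => hki.
    have d0 : (0 < m - k)%N by rewrite subn_gt0.
    have dm : (m - k < m)%N by move: k0 km; clear; lia.
    have jd : (i.+1 + 3 * (m - k) = q)%N by move: hq hki hik km; clear; lia.
    case/eqP: (node_neq d0 dm jd); apply/eqP; rewrite -subr_eq0 -[X in _ == X]ls lE.
    have eA : (zeta - s) ^+ i.+1 * (zeta - S) = (zeta - s) * A by rewrite exprS mulrA.
    have eB : (zeta ^+ 2 - s) ^+ i.+1 * (zeta ^+ 2 - S) = (zeta ^+ 2 - s) * B.
      by rewrite exprS mulrA.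
    by rewrite eA eB; apply/eqP; ring.
  have [u1 u2] := zeta_sub_neq0 s2_neq0.
  exists (l + ('X - zeta%:P) * ('X - (zeta ^+ 2)%:P))%R; split.
  - suff : (size (l + ('X - zeta%:P) * ('X - (zeta ^+ 2)%:P))%R <= 3)%N.
      by move: ik; move: (size _) => n; clear; lia.
    apply: (leq_trans (size_polyD _ _)); rewrite geq_max (leq_trans sl) //=.
    by rewrite size_mul ?polyXsubC_eq0 // !size_XsubC.
  - by rewrite !hornerD !hornerM !hornerXsubC !subrr mul0r mulr0 !addr0.
  - rewrite hornerD ls add0r hornerM !hornerXsubC -(opprB zeta) -(opprB (zeta ^+ 2)).
    by rewrite mulrNN mulf_neq0.
exists (('X - s%:P) ^+ i * (('X - S%:P) * g1)), (('X - S%:P) * g1); split=> //.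
- have -> : ('X - s%:P) ^+ i * (('X - S%:P) * g1) = ('X - s%:P) ^+ i * ('X - S%:P) * g1.
    by rewrite mulrA.
  apply: (leq_trans (size_polyMleq _ _)).
  rewrite size_mul ?expf_neq0 ?polyXsubC_eq0 // size_exp_XsubC size_XsubC.
  by move: sg1; move: (size g1) => n; clear; lia.
- by rewrite !(hornerM, horner_exp, hornerXsubC) !mulrA -/A -/B.
- by rewrite !hornerM hornerXsubC subrr mul0r mulr0.
- by rewrite hornerM hornerXsubC mulf_neq0 // subr_eq0 eq_sym S_neq_s.
Qed.

Context {v : F -> int} (hv : is_place_valuation iota v)
  (vx : res iota v x a) (vy : res iota v y b).

Let rPX : res iota v X (s ^+ 3). Proof. by rewrite -aqa; apply: res_X. Qed.
Let rPY : res iota v Y (- s - s ^+ 2). Proof. by rewrite -bqb; apply: res_Y. Qed.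

Lemma conj_place : exists2 w, is_place_valuation iota w &
  [/\ res iota w x (a ^+ (q ^ 2)), res iota w y (b ^+ (q ^ 2)),
      res iota w X (S ^+ 3) & res iota w Y (- S - S ^+ 2)].
Proof.
have b2 : b ^+ (q ^ 2) != 0 by rewrite expf_neq0 // b_neq0.
have [w hw [w1 wy]] := unramified_place hq m_gt0 qK hF b2 conj_on_curve.
have wx : res iota w x (a ^+ (q ^ 2)) by rewrite /res vgeE ?w1 // (x_neq hF).
exists w => //; split=> //; first by rewrite -aqq; apply: res_X.
by rewrite -opprD -bqq; apply: res_Y.
Qed.

Lemma semigroup_mem k i : (0 < k)%N -> (i < q)%N ->
  (i + 3 <= 3 * k \/ i + 2 <= 3 * k /\ k < m)%N ->
  in_weierstrass iota v (k * q - i).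
Proof.
move=> k0 lt_iq hk; have [g [g2 [sg gz gS eg g2s]]] := numerator k0 hk.
have [h0 [h1 [h2 [sh0 sh1 sh2 egh]]]] := nodal_restriction zeta3 zeta_neq sg gz.
(* [N] lifts [g] from the tangent line: it has degree at most [k] in [X] and [Y], and agrees with
   [g(tau)] up to the order of [lam] at [P] and [P']. *)
pose N := (map_poly iota h0).[X] + (map_poly iota h1).[X] * Y + (map_poly iota h2).[X] * Y ^+ 2.
have gtau : (map_poly iota g).[tau] = (map_poly iota h0).[tau ^+ 3] +
    (map_poly iota h1).[tau ^+ 3] * (- tau - tau ^+ 2) +
    (map_poly iota h2).[tau ^+ 3] * (- tau - tau ^+ 2) ^+ 2.
  by rewrite egh horner_nodal.
have Ncong w n t : is_place_valuation iota w -> t != 0 -> 1 + t + t ^+ 2 != 0 ->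
    res iota w X (t ^+ 3) -> res iota w Y (- t - t ^+ 2) -> vge w n lam ->
    vge w n (N - (map_poly iota g).[tau]).
  move=> hw t0 t2 rX rY hl; have [cX cY _] := vge_lam hw t2 rX rY hl.
  have wt := vge_tau hw t2 rX rY.
  have [wX wY] := (res_vge0 hw rX, res_vge0 hw rY).
  have wt3 := vge0X hw 3 wt.
  have wt2 : vge w 0 (- tau - tau ^+ 2).
    by apply: (vgeB hw); [rewrite (vgeN hw) | apply: (vge0X hw)].
  rewrite gtau /N; apply: (vge_congD hw); first apply: (vge_congD hw).
  - exact: (vge_cong_poly hw).
  - by apply: (vge_congM hw) => //; [apply: (vge_poly hw) | apply: (vge_cong_poly hw)].
  - apply: (vge_congM hw).
    + exact: (vge0X hw).
    + exact: (vge_poly hw).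
    + exact: (vge_cong_poly hw).
    + exact: (vge_congX hw).
have Nfin w : is_place_valuation iota w -> vge w 0 X -> vge w 0 Y -> vge w 0 N.
  move=> hw wX wY; apply: (vgeD hw); first apply: (vgeD hw); first exact: (vge_poly hw).
    by apply: (vge0M hw) => //; apply: (vge_poly hw).
  by apply: (vge0M hw); [apply: (vge_poly hw) | apply: (vge0X hw)].
have Ninf w : is_place_valuation iota w -> w x < 0 -> vge w (w x * k%:Z) N.
  move=> hw wx; have [_ wy] := tangent_inf hw wx; have wx0 := ltW wx.
  have wX : vge w (w x) X.
    by apply: (vge0M hw); [apply: vge_iota | rewrite vgeE // (x_neq0 hF)].
  have wY : vge w (w x) Y by apply: (vge0M hw) => //; apply: vge_iota.
  have k1 : (size h1 <= k.-1.+1)%N by rewrite prednK.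
  have pole := vge_poly_pole hw.
  apply: (vgeD hw); first apply: (vgeD hw); first exact: pole.
    apply: vgeW (vgeM hw (pole _ _ _ _ wx0 wX k1) wY).
    by move: k0; move: (w x); clear; case: k => // k n _ /=; lia.
  have [k2|k2] := leqP 2 k; last first.
    have -> : h2 = 0 by apply/eqP; rewrite -size_poly_leq0 (leq_trans sh2) // -subn1 leq_subLR.
    by rewrite rmorph0 horner0 mul0r vge0.
  have s2 : (size h2 <= k.-2.+1)%N by move: sh2 k2; clear; lia.
  apply: vgeW (vgeM hw (pole _ _ _ _ wx0 wX s2) (vgeX hw 2 wY)).
  by move: k2; rewrite mulr2n; move: (w x); clear; case: k => [|[|k]] // n _ /=; lia.
clearbody N; clear h0 h1 h2 sh0 sh1 sh2 egh gtau.
have l0 := lam_neq0; have [vl ts0 vts] := tangent_order hv vx vy.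
have [g2t0 vg2] := res_unit hv (res_poly hv g2 (res_tau hv s2_neq0 rPX rPY)) g2s.
have gt0 : (map_poly iota g).[tau] != 0 /\ v (map_poly iota g).[tau] = i.
  rewrite eg rmorphM rmorphXn rmorphB /= map_polyX map_polyC hornerM horner_exp hornerXsubC.
  rewrite mulf_neq0 ?expf_neq0 //; split=> //.
  by rewrite (vM hv) ?expf_neq0 // (vX hv) // vts vg2 addr0 natz.
pose G := (map_poly iota g).[tau]; rewrite -/G in Ncong gt0.
have w'G w : is_place_valuation iota w -> res iota w tau S -> vge w 1 G.
  by move=> hw rt; rewrite -(res0 (iota := iota)) -gS; apply: (res_poly hw).
clearbody G.
have [N0 vN] : N != 0 /\ v N = i.
  rewrite -[N](subrK G) addrC; case: gt0 => gt0 vgt.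
  apply: (vD_eq hv gt0 vgt); apply: (@vgeW _ _ q); first by move: lt_iq; clear; lia.
  by apply: (Ncong v q s hv s_neq0 s2_neq0 rPX rPY); rewrite vgeE // vl.
have [w' hw' [w'x w'y w'X w'Y]] := conj_place.
have [w'l w'tau] := tangent_conjugate hw' w'x w'y.
have w'N : vge w' 1 N.
  rewrite -[N](subrK G); apply: (vgeD hw'); last exact: w'G.
  by apply: (Ncong w' 1 S hw' S_neq0 S2_neq0 w'X w'Y); rewrite vgeE // w'l.
have lk0 : lam ^- k != 0 by rewrite invr_eq0 expf_neq0.
have vlk w : is_place_valuation iota w -> w (lam ^- k) = - (w lam * k%:Z).
  by move=> hw; rewrite (vV hw) ?expf_neq0 // (vX hw) // -mulr_natr natz.
have b'0 : b ^+ (q ^ 2) != 0 by rewrite expf_neq0 // b_neq0.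
(* As [N] vanishes at [P'], [N / lam^k] has a pole of order at most [k - 1] there, removed by a
   polynomial of degree at most [k - 1] in [1 / lam]. At [P] the latter has pole order at most
   [(k - 1) q], less than [k q - i]. *)
have [|pp [spp hpp]] := polar_part hw' l0 w'l
    (fun f => unramified_residue hq m_gt0 qK hF b'0 conj_on_curve hw' w'x w'y (f := f))
    (r := k.-1) (f := lam ^- k * N).
  rewrite (vgeMr hw') // vlk // w'l; apply: vgeW w'N.
  by move: k0; clear; lia.
pose f := lam ^- k * N - (map_poly iota pp).[lam^-1].
have [f0 vf] : f != 0 /\ v f = i%:Z - (k * q)%:Z.
  apply: (vD_eq hv); first by rewrite mulf_neq0.
    by rewrite (vM hv) // vlk // vl vN; clear; lia.
  have wl : vge v (- q%:Z) lam^-1 by rewrite vgeE ?invr_eq0 // (vV hv) // vl.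
  have c0 : - q%:Z <= 0 by rewrite oppr_le0.
  rewrite (vgeN hv); apply: vgeW (vge_poly_pole hv c0 wl spp).
  by move: k0 lt_iq; clear; case: k => // k _ h /=; nia.
exists f; split=> //.
  by rewrite vf -subzn ?opprB // (leq_trans (ltnW lt_iq)) // leq_pmull.
move=> w hw wv; rewrite -(vgeE w 0 f0).
have [wx|wx] := boolP (vge w 0 x); last first.
  have {}wx : w x < 0 by move: wx; rewrite vgeE ?(x_neq0 hF) // ltNge.
  have [wl _] := tangent_inf hw wx.
  apply: (vgeB hw); last first.
    apply: (vge_poly hw); rewrite vgeE ?invr_eq0 // (vV hw) // wl.
    by move: wx; clear; lia.
  rewrite (vgeMr hw) // vlk // wl; apply: vgeW (Ninf w hw wx).
  by clear; lia.
have [wX wY wl] := finite_regular hw wx.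
have [wl1|wl1] := boolP (vge w 1 lam); last first.
  have wl0 : w lam = 0.
    by move: wl wl1; rewrite !vgeE // -ltNge; move: (w lam) => n; clear; lia.
  apply: (vgeB hw); last by apply: (vge_poly hw); rewrite vgeE ?invr_eq0 // (vV hw) // wl0.
  by rewrite (vgeMr hw) // vlk // wl0 mul0r oppr0 subr0; apply: Nfin.
have [[wxa wyb]|[wxa wyb]] := tangent_zeros hw wx wl1.
  case: wv; exact: (unramified_same hq m_gt0 qK hF b_neq0 hab hw hv wxa wyb vx vy).
rewrite vgeE // (unramified_same hq m_gt0 qK hF b'0 conj_on_curve hw hw' wxa wyb w'x w'y f0).
by rewrite -(vgeE w' 0 f0).
Qed.

(** The property is additive, and [nodal_monomial] gives it for each rescaled monomial of degree at
    most [k] in [X], [Y], [Z]. *)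
Lemma restriction k (h : 'I_(3 * m) -> {poly K}) w' : is_place_valuation iota w' ->
  res iota w' x (a ^+ (q ^ 2)) -> res iota w' y (b ^+ (q ^ 2)) ->
  (forall (r : 'I_(3 * m)) i, (k < i + kdeg r)%N -> (h r)`_i = 0) ->
  let f := \sum_r phi iota x (h r) * @kbasis F x y r in
  exists G : {poly K}, [/\ (size G <= (3 * k).+1)%N, G.[zeta] = G.[zeta ^+ 2],
    vge v q (f - (map_poly iota G).[tau]) & vge w' 1 (f - (map_poly iota G).[tau])].
Proof.
move=> hw' w'x w'y hb; have w'X : res iota w' X (S ^+ 3) by rewrite -aqq; apply: res_X.
have w'Y : res iota w' Y (- S - S ^+ 2) by rewrite -opprD -bqq; apply: res_Y.
pose P f := exists G : {poly K}, [/\ (size G <= (3 * k).+1)%N, G.[zeta] = G.[zeta ^+ 2],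
    vge v q (f - (map_poly iota G).[tau]) & vge w' 1 (f - (map_poly iota G).[tau])].
have P0 : P 0 by exists 0; rewrite size_poly0 !horner0 rmorph0 horner0 subr0 !vge0.
have PD f f' : P f -> P f' -> P (f + f').
  move=> [G [sG zG vG wG]] [G' [sG' zG' vG' wG']]; exists (G + G'); split.
  - by rewrite (leq_trans (size_polyD _ _)) // geq_max sG sG'.
  - by rewrite !hornerD zG zG'.
  - by rewrite rmorphD /= hornerD; apply: (vge_congD hv).
  - by rewrite rmorphD /= hornerD; apply: (vge_congD hw').
have cong w n t i j l : is_place_valuation iota w -> t != 0 -> 1 + t + t ^+ 2 != 0 ->
    res iota w X (t ^+ 3) -> res iota w Y (- t - t ^+ 2) -> vge w n lam ->
    vge w n (X ^+ i * Y ^+ j * Z ^+ l -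
      (tau ^+ 3) ^+ i * (- tau - tau ^+ 2) ^+ j * (- (1 + tau) ^+ 3) ^+ l).
  move=> hw t0 t2 rX rY hl; have [cX cY cZ] := vge_lam hw t2 rX rY hl.
  have wt := vge_tau hw t2 rX rY.
  have [wX wY] := (res_vge0 hw rX, res_vge0 hw rY).
  have wZ := res_vge0 hw (res_Z hw t0 rX rY).
  have wt3 := vge0X hw 3 wt.
  have wt2 : vge w 0 (- tau - tau ^+ 2).
    by apply: (vgeB hw); [rewrite (vgeN hw) | apply: (vge0X hw)].
  have wt1 : vge w 0 (- (1 + tau) ^+ 3).
    by rewrite (vgeN hw); apply: (vge0X hw); apply: (vgeD hw); first exact: (vge1 hw).
  apply: (vge_congM hw).
  - exact: (vge0X hw).
  - by apply: (vge0M hw); apply: (vge0X hw).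
  - by apply: (vge_congM hw); [exact: (vge0X hw) | exact: (vge0X hw) |
      exact: (vge_congX hw) | exact: (vge_congX hw)].
  - exact: (vge_congX hw).
have [vl _ _] := tangent_order hv vx vy; have [wl _] := tangent_conjugate hw' w'x w'y.
have l0 := lam_neq0.
have vln : vge v q lam by rewrite vgeE // vl.
have wln : vge w' 1 lam by rewrite vgeE // wl.
have Pmono c i j l : (i + j + l <= k)%N -> P (iota c * (X ^+ i * Y ^+ j * Z ^+ l)).
  move=> hk; have [G [sG eG zG]] := nodal_monomial iota c i j l; exists G; split.
  - by apply: leq_trans sG _; rewrite ltnS leq_mul2l hk.
  - have z2 := zeta_sum; have z3 := zeta3.
    have z4 : (zeta ^+ 2) ^+ 2 = zeta by rewrite -exprM (exprD zeta 3 1) z3 mul1r.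
    rewrite (zG _ z3 z2) zG // ?z4; first by rewrite -exprM mulnC exprM z3 expr1n.
    by rewrite addrAC.
  - rewrite eG -mulrBr; apply: (vge0M hv); first exact: vge_iota.
    exact: (cong v q s i j l hv s_neq0 s2_neq0 rPX rPY).
  - rewrite eG -mulrBr; apply: (vge0M hw'); first exact: vge_iota.
    exact: (cong w' 1 S i j l hw' S_neq0 S2_neq0 w'X w'Y).
move=> f; change (P f); rewrite /f {f}; clearbody P; apply: (big_ind P) => // r _.
rewrite phiE horner_coef mulr_suml; apply: (big_ind P) => // i _.
rewrite coef_map /=; have [ik|ki] := leqP (i + kdeg r)%N k; last first.
  by rewrite hb // rmorph0 !mul0r.
have aq0 : a ^+ q != 0 by rewrite expf_neq0.
have bq0 : b ^+ q != 0 by rewrite expf_neq0 // b_neq0.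
pose c := (h r)`_i / (a ^+ q) ^+ i / (b ^+ q) ^+ (r %% 3) *
  (a ^+ q / (b ^+ q) ^+ 3) ^+ (r %/ 3).
suff -> : iota (h r)`_i * x ^+ i * @kbasis F x y r =
    iota c * (X ^+ i * Y ^+ (r %% 3) * Z ^+ (r %/ 3)).
  by apply: Pmono; rewrite -addnA [(r %% 3 + _)%N]addnC.
have ec : iota c = iota (h r)`_i / iota (a ^+ q) ^+ i / iota (b ^+ q) ^+ (r %% 3) *
    (iota (a ^+ q) / iota (b ^+ q) ^+ 3) ^+ (r %/ 3).
  by rewrite /c; move: (a ^+ q) (b ^+ q) => A B; rewrite !(fmorph_div, fmorphV, rmorphM, rmorphXn).
by rewrite ec /kbasis -rescale_monomial ?fmorph_eq0 // (x_neq0 hF).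
Qed.

Lemma semigroup_gap k i : (0 < k)%N -> (i < q)%N -> in_weierstrass iota v (k * q - i) ->
  (i + 3 <= 3 * k \/ i + 2 <= 3 * k /\ k < m)%N.
Proof.
move=> k0 lt_iq [f [f0 vf hf]]; have l0 := lam_neq0.
have [vl ts0 vts] := tangent_order hv vx vy.
(* [hf] controls [w f] only at places other than [v]; for a boolean goal the two cases are separated
   by contradiction. *)
have hcase w (P : bool) : is_place_valuation iota w ->
    (vge w 0 f -> P) -> (same_place w v -> P) -> P.
  move=> hw h1 h2; apply: contraT => nP; move: h1; rewrite vgeE // (negbTE nP) hf //.
    by move=> /(_ isT).
  by move/h2; rewrite (negbTE nP).
have lk0 : lam ^+ k != 0 by rewrite expf_neq0.
have vlk w : is_place_valuation iota w -> w (lam ^+ k) = w lam * k%:Z.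
  by move=> hw; rewrite (vX hw) // -mulr_natr natz.
pose g := f * lam ^+ k; have g0 : g != 0 by rewrite mulf_neq0.
have vg : v g = i.
  rewrite (vM hv) // vlk // vl vf -subzn; first by clear; lia.
  by rewrite (leq_trans (ltnW lt_iq)) // leq_pmull.
have gfin w : is_place_valuation iota w -> vge w 0 x -> vge w 0 g.
  move=> hw wx; apply: (hcase w) => // [wf|wv].
    by apply: (vge0M hw) => //; apply: (vge0X hw); have [] := finite_regular hw wx.
  by rewrite vgeE // wv // vg.
have ginf w : is_place_valuation iota w -> w x < 0 -> vge w (k%:Z * w x) g.
  move=> hw wx; apply: (hcase w) => // [wf|wv].
    by apply: (vge0M hw) => //; rewrite vgeE // vlk // (proj1 (tangent_inf hw wx)) mulrC.
  have := res_vge0 hv vx; rewrite vgeE ?(x_neq0 hF) // -wv ?(x_neq0 hF) //.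
  by rewrite leNgt wx.
have [w' hw' [w'x w'y w'X w'Y]] := conj_place.
have [w'l w'tau] := tangent_conjugate hw' w'x w'y.
have w'g : vge w' 1 g.
  apply: (hcase w') => // [wf|wv].
    by apply: (vge0M hw') => //; rewrite vgeE // vlk // w'l mul1r.
  (* [lam] has order 1 at this place and order [q > 1] at [v]. *)
  by have := wv lam l0; rewrite w'l vl => -[q1]; have := q_gt1; rewrite -q1.
have [h eg] := finite_normality hq m_gt0 qK hF gfin.
have hb : forall (r : 'I_(3 * m)) i, (k < i + kdeg r)%N -> (h r)`_i = 0.
  by apply: (degree_bound hq m_gt0 qK hF) => w hw wx; rewrite -eg; apply: ginf.
have [G [sG zG vG wG]] := restriction hw' w'x w'y hb.
rewrite -eg in vG wG; move: g0 vg w'g vG wG; clearbody g.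
clear f f0 vf hf hcase gfin ginf h eg hb => g0 vg w'g vG wG.
have [Gt0 vGt] : (map_poly iota G).[tau] != 0 /\ v (map_poly iota G).[tau] = i.
  rewrite -[(map_poly iota G).[tau]](subrK g) addrC; apply: (vD_eq hv) => //.
  by rewrite -opprB (vgeN hv); apply: vgeW vG; move: lt_iq; clear; lia.
have G0 : G != 0 by apply: contraNneq Gt0 => ->; rewrite rmorph0 horner0.
have [M [G1]] := multiplicity_XsubC G s; rewrite G0 /= => G1s eG.
have [G1t vG1] := res_unit hv (res_poly hv G1 (res_tau hv s2_neq0 rPX rPY)) G1s.
have eM : M = i.
  move: vGt; rewrite eG rmorphM rmorphXn rmorphB /= map_polyX map_polyC.
  rewrite hornerM horner_exp hornerXsubC (vM hv) ?expf_neq0 // vG1 (vX hv) // vts.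
  by rewrite add0r natz => -[].
rewrite {M}eM in eG.
have GS : G.[S] = 0.
  apply: (res_uniq hw' (res_poly hw' G w'tau)); rewrite res0.
  by rewrite -[(map_poly iota G).[tau]](subKr g) (vgeB hw').
have [G2 eG1] : exists G2, G1 = G2 * ('X - S%:P).
  apply/factor_theorem; move/eqP: GS.
  rewrite eG hornerM horner_exp hornerXsubC mulf_eq0 expf_eq0 subr_eq0.
  by rewrite (negbTE S_neq_s) andbF orbF.
have G20 : G2 != 0 by apply: contraNneq G0 => h; rewrite eG eG1 h !mul0r.
have sG2 : (size G2 + i <= 3 * k)%N.
  move: sG; rewrite eG eG1 size_mul ?expf_neq0 ?mulf_neq0 ?polyXsubC_eq0 //.
  rewrite size_exp_XsubC size_mul ?polyXsubC_eq0 // size_XsubC.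
  by move: (size G2) => n; clear; lia.
have sG2_gt0 : (0 < size G2)%N by rewrite size_poly_gt0.
have eval u : G.[u] = (u - s) ^+ i * (u - S) * G2.[u].
  by rewrite eG eG1 !hornerM horner_exp !hornerXsubC; ring.
have [|lt_ki] := leqP (i + 3) (3 * k); first by left.
(* If [3 k = i + 1], the remaining factor [G2] is constant, and equality at the node contradicts
   [node_neq] with [d = m - k]. *)
right; have [le_ik|lt_ki2] := leqP (i + 2) (3 * k); last first.
  have km : (k < m)%N by move: lt_iq sG2 sG2_gt0 lt_ki2 hq; move: (size G2) => n; clear; lia.
  have sG21 : (size G2 <= 1)%N by move: sG2 lt_ki2; move: (size G2) => n; clear; lia.
  have d0 : (0 < m - k)%N by rewrite subn_gt0.
  have dm : (m - k < m)%N by move: k0 km; clear; lia.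
  have jd : (i + 3 * (m - k) = q)%N.
    by move: hq lt_ki2 km sG2 sG2_gt0; move: (size G2) => n; clear; lia.
  case/eqP: (node_neq d0 dm jd).
  have [c eG2] : exists c, G2 = c%:P by exists G2`_0; apply: size1_polyC.
  have c0 : c != 0 by apply: contraNneq G20 => c0; rewrite eG2 c0.
  by apply: (mulIf c0); move: zG; rewrite !eval eG2 !hornerC.
split=> //; rewrite ltnNge; apply/negP => le_mk.
(* Here [3 k = i + 2] and [k >= m], so [i < q] forces [i = q - 1]. Comparing the node condition with
   [node_curve] makes [G2], of degree at most 1, vanish at [s], against the multiplicity [i]. *)
have iq : i.+1 = q by move: lt_iq le_ik le_mk lt_ki hq; clear; lia.
have sG22 : (size G2 <= 2)%N by move: sG2 lt_ki; move: (size G2) => n; clear; lia.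
case/negP: G1s; rewrite eG1 rootM; apply/orP; left.
have eG2 u : G2.[u] = G2`_0 + G2`_1 * u.
  by rewrite (horner_coef_wide _ sG22) !big_ord_recl big_ord0 /= expr0 expr1 mulr1 addr0.
have [u0 u0'] := zeta_sub_neq0 s2_neq0; have [U0 U0'] := zeta_sub_neq0 S2_neq0.
move: zG; have := node_curve; rewrite -iq !eval (exprS (zeta - s)) (exprS (zeta ^+ 2 - s)).
rewrite -(mulrA (zeta - s)) -(mulrA (zeta ^+ 2 - s)).
have P20 : (zeta ^+ 2 - s) ^+ i * (zeta ^+ 2 - S) != 0 by rewrite mulf_neq0 ?expf_neq0.
move: ((zeta - s) ^+ i * _) (_ * (zeta ^+ 2 - S)) P20 => P1 P2 P20 eP eG2P.
have zz : zeta ^+ 2 - zeta != 0 by rewrite subr_eq0 eq_sym zeta_neq.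
have e2 : (zeta ^+ 2 - s) * G2.[zeta] = (zeta - s) * G2.[zeta ^+ 2].
  by apply: (mulfI P20); rewrite mulrCA mulrA -eP -mulrA eG2P; ring.
apply/rootP; apply: (mulfI zz); rewrite mulr0.
transitivity ((zeta ^+ 2 - s) * G2.[zeta] - (zeta - s) * G2.[zeta ^+ 2]); last first.
  by rewrite e2 subrr.
by rewrite !eG2; ring.
Qed.

End CubeRoot.

End Tangent.

(** * Arithmetic of the pole numbers *)

Lemma in_weierstrass0 (K F : fieldType) (iota : {rmorphism K -> F}) v :
  is_place_valuation iota v -> in_weierstrass iota v 0.
Proof.
move=> hv; exists 1; split; rewrite ?oner_neq0 ?(v1 hv) //.
by move=> w hw _; rewrite (v1 hw).
Qed.

Lemma ceil_divn q n : (0 < q)%N -> (0 < n)%N ->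
  exists k i, [/\ (0 < k)%N, (i < q)%N, (i <= k * q)%N & n = (k * q - i)%N].
Proof.
move=> q0 n0; exists (n.-1 %/ q).+1, (q - (n.-1 %% q).+1)%N.
have := divn_eq n.-1 q; have := ltn_pmod n.-1 q0.
by move: (n.-1 %/ q)%N (n.-1 %% q)%N => d r lt_r e; split; nia.
Qed.

Section PoleNumbers.
Context (q m : nat) (hq : q.+1 = (3 * m)%N) (H : nat -> Prop) (H0 : H 0%N)
  (H_mem : forall k i, (0 < k)%N -> (i < q)%N ->
     (i + 3 <= 3 * k \/ i + 2 <= 3 * k /\ k < m)%N -> H (k * q - i)%N)
  (H_gap : forall k i, (0 < k)%N -> (i < q)%N -> H (k * q - i)%N ->
     (i + 3 <= 3 * k \/ i + 2 <= 3 * k /\ k < m)%N).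

Let q0 : (0 < q)%N. Proof. by clear -hq; lia. Qed.

Lemma gaps_of_pole_numbers n : (0 < n)%N -> ~ H n <->
  (exists j k : nat, [/\ (j + 2 <= m)%N, (1 <= k)%N, (k + 3 * j + 2 <= q)%N
     & n = (j * q + k)%N]) \/ n = ((m - 1) * q + 1)%N.
Proof.
move=> n0; split; last first.
  case=> [[j [k [jm k1 kq ->]]]|-> Hn].
    have -> : (j * q + k = j.+1 * q - (q - k))%N by clear -kq; nia.
    have ik : (q - k < q)%N by clear -k1 q0; lia.
    by move/(H_gap (ltn0Sn j) ik); clear -kq k1; lia.
  have e : ((m - 1) * q + 1 = m * q - q.-1)%N by clear -hq; nia.
  have m0 : (0 < m)%N by clear -hq; lia.
  have iq : (q.-1 < q)%N by rewrite prednK.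
  by move: Hn; rewrite e => /(H_gap m0 iq); clear -hq; lia.
move=> nH; have [k [i [k0 iq le_i en]]] := ceil_divn q0 n0.
have ncond : ~ (i + 3 <= 3 * k \/ i + 2 <= 3 * k /\ k < m)%N.
  by move=> /(H_mem k0 iq); rewrite -en.
have [km|mk] := ltnP k m.
  left; exists k.-1, (q - i)%N; move: ncond; rewrite en; clear -km k0 iq le_i => nc.
  by split; [lia | lia | lia | nia].
(* The isolated gap: the case [i + 2 = 3 k] gives a pole number only for [k < m]. *)
have [ei ek] : i = q.-1 /\ k = m by move: ncond; clear -hq mk iq; lia.
by right; rewrite en ei ek; clear -hq; nia.
Qed.

Lemma pole_numbersE n : H n <->
  (n = 0%N
   \/ (exists j k : nat, [/\ (j + 2 <= m)%N, (k <= 3 * j + 1)%N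
         & n = ((j + 1) * (q - 3) + 2 + k)%N])
   \/ ((m - 1) * q + 2 <= n)%N).
Proof.
split=> [Hn|[->//|[[j [k [jm kj ->]]]|le_n]]].
- have [->|n0] := posnP n; first by left.
  right; have [k [i [k0 iq le_i en]]] := ceil_divn q0 n0.
  move: Hn; rewrite en => /(H_gap k0 iq) cond; have [km|mk] := ltnP k m.
    (* [(j + 1) (q - 3) + 2] corresponds to [i = 3 j + 1], the largest [i] allowed for [k = j + 1];
       the offset counts down from it. *)
    left; exists k.-1, (3 * k - 2 - i)%N; move: cond; clear -hq km k0 iq le_i => cond.
    by split; [lia | lia | nia].
  by right; move: cond; clear -hq mk iq k0; nia.
- have -> : ((j + 1) * (q - 3) + 2 + k = j.+1 * q - (3 * j + 1 - k))%N.
    by clear -hq jm kj; nia.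
  by apply: H_mem => //; clear -hq jm kj; lia.
have n0 : (0 < n)%N by apply: leq_trans le_n; rewrite addn2.
have [k [i [k0 iq le_i en]]] := ceil_divn q0 n0.
rewrite en; apply: H_mem => //; left; move: le_n; rewrite en; clear -hq k0 iq le_i => le_n.
have mk : (m <= k)%N by rewrite leqNgt; apply/negP => lt_km; nia.
by nia.
Qed.

End PoleNumbers.

Unset Implicit Arguments.

Theorem theorem5p1
  (K : closedFieldType) (p e q m : nat)
  (hp : prime p) (he : (0 < e)%N) (hq : q = (p ^ e)%N)
  (hpK : p \in [pchar K])
  (hKalg : forall a : K, exists n : nat, (0 < n)%N /\ a ^+ (p ^ n) = a)
  (hq3 : (q %% 3 = 2)%N) (hm : m = ((q + 1) %/ 3)%N)
  (zeta : K) (hz : 3.-primitive_root zeta)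
  (F : fieldType) (iota : {rmorphism K -> F}) (x y : F)
  (hF : is_function_field_X3 iota q m x y)
  (a b : K) (ha : a != 0)
  (hab : b ^+ q.+1 + a ^+ (2 * m) + a ^+ m = 0)
  (hnotrat : ~~ ((a ^+ (q ^ 2) == a) && (b ^+ (q ^ 2) == b)))
  (hPj : forall j : nat, (2 <= j)%N -> (j <= m - 1)%N ->
           Pval zeta j (alpha m a) != 0)
  (v : F -> int) (hv : is_place_valuation iota v)
  (hvx : 0 < v (x - iota a)) (hvy : 0 < v (y - iota b)) :
  (forall n : nat, (0 < n)%N ->
     (~ in_weierstrass iota v n <->
      ((exists j k : nat, [/\ (j + 2 <= m)%N, (1 <= k)%N, (k + 3 * j + 2 <= q)%N
                             & n = (j * q + k)%N])
       \/ n = ((m - 1) * q + 1)%N)))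
  /\
  (forall n : nat,
     in_weierstrass iota v n <->
     (n = 0%N
      \/ (exists j k : nat, [/\ (j + 2 <= m)%N, (k <= 3 * j + 1)%N
                             & n = ((j + 1) * (q - 3) + 2 + k)%N])
      \/ ((m - 1) * q + 2 <= n)%N)).
Proof.
have hq1 : q.+1 = (3 * m)%N by rewrite hm; clear -hq3; lia.
have m0 : (0 < m)%N by clear -hq1; lia.
have q_0 := qK hpK he hq.
have vx : res iota v x a by rewrite /res vgeE // (x_neq hF).
have vy : res iota v y b by rewrite /res vgeE // (y_neq hq1 m0 hF).
have H0 := in_weierstrass0 hv.
have H_mem k i k0 iq cond :=
  @semigroup_mem _ _ _ _ _ _ _ hpK he hq hq1 m0 _ _ hF _ _ ha hab hnotrat _ hz hPj
     _ hv vx vy k i k0 iq cond.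
have H_gap k i k0 iq cond :=
  @semigroup_gap _ _ _ _ _ _ _ hpK he hq hq1 m0 _ _ hF _ _ ha hab hnotrat _ hz hPj
     _ hv vx vy k i k0 iq cond.
by split=> n; [apply: gaps_of_pole_numbers | apply: pole_numbersE].
Qed.
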